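(* Let $\mathbf{L}\in Q^2(\mathbb{D}^2)$. An analytic function $F\colon\mathbb{D}^2\to\mathbb{C}$ has bounded $\mathbf{L}$-index in joint variables if and only if for each $R=(r_1,r_2)\in(0,\beta]\times(0,\beta]$ there exist $n_0\in\mathbb{Z}_+$ and $p_0>0$ such that for every $z^0=(z_1^0,z_2^0)\in\mathbb{D}^2$ there exists $(k_1^0,k_2^0)\in\mathbb{Z}_+^2$ with $0\le k_1^0+k_2^0\le n_0$ and $$\max\left\{\frac{|F^{(k_1,k_2)}(z)|}{k_1!k_2!\,l_1^{k_1}(z)l_2^{k_2}(z)}: k_1+k_2\le n_0,\ z\in\mathbb{D}^2\Big[z^0,\frac{R}{\mathbf{L}(z^0)}\Big]\right\}\le \frac{p_0}{k_1^0!k_2^0!}\,\frac{|F^{(k_1^0,k_2^0)}(z^0)|}{l_1^{k_1^0}(z^0)\,l_2^{k_2^0}(z^0)}.$$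
   Context: $\mathbb{D}^2=\{(z_1,z_2)\in\mathbb{C}^2:|z_1|<1,|z_2|<1\}$, $\mathbb{Z}_+=\{0,1,2,\dots\}$, $\mathbb{R}_+=[0,\infty)$. A constant $\beta>1$ is fixed. $\mathbf{L}(z)=(l_1(z),l_2(z))$, where each $l_j\colon\mathbb{D}^2\to\mathbb{R}_+$ is continuous and satisfies $l_j(z_1,z_2)>\beta/(1-|z_j|)$ for all $(z_1,z_2)\in\mathbb{D}^2$, $j=1,2$. For $z^0\in\mathbb{C}^2$ and $R=(r_1,r_2)\in\mathbb{R}_+^2$: $\mathbb{D}^2[z^0,R]=\{z:|z_j-z_j^0|\le r_j,\ j=1,2\}$ and $\frac{R}{\mathbf{L}(z^0)}=\big(\frac{r_1}{l_1(z^0)},\frac{r_2}{l_2(z^0)}\big)$. $F^{(p,q)}=\frac{\partial^{p+q}F}{\partial z_1^p\partial z_2^q}$. An analytic $F\colon\mathbb{D}^2\to\mathbb{C}$ has bounded $\mathbf{L}$-index in joint variables if there is $n_0\in\mathbb{Z}_+$ such that for all $z\in\mathbb{D}^2$ and all $(p_1,p_2)\in\mathbb{Z}_+^2$: $\frac{|F^{(p_1,p_2)}(z)|}{p_1!p_2!\,l_1^{p_1}(z)l_2^{p_2}(z)}\le\max\{\frac{|F^{(k_1,k_2)}(z)|}{k_1!k_2!\,l_1^{k_1}(z)l_2^{k_2}(z)}:0\le k_1+k_2\le n_0\}$. $Q^2(\mathbb{D}^2)$ is the class of such $\mathbf{L}$ for which, for all $R=(r_1,r_2)\in[0,\beta]^2$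 and $j=1,2$, $0<\lambda_{1,j}(R)\le\lambda_{2,j}(R)<\infty$, where $\lambda_{1,j}(R)=\inf_{z^0\in\mathbb{D}^2}\inf\{l_j(z)/l_j(z^0): z\in\mathbb{D}^2[z^0,R/\mathbf{L}(z^0)]\}$ and $\lambda_{2,j}(R)=\sup_{z^0\in\mathbb{D}^2}\sup\{l_j(z)/l_j(z^0): z\in\mathbb{D}^2[z^0,R/\mathbf{L}(z^0)]\}$. *)

(* Defs.v *)
From Stdlib Require Import Reals Lra Arith Factorial.
From Coquelicot Require Import Coquelicot.
Open Scope R_scope.

Definition bidisc (z : C * C) : Prop := Cmod (fst z) < 1 /\ Cmod (snd z) < 1.

Definition cpolydisc (z0 : C * C) (r1 r2 : R) (z : C * C) : Prop :=
  Cmod (fst z - fst z0)%C <= r1 /\ Cmod (snd z - snd z0)%C <= r2.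

Definition d1 (G : C * C -> C) : C * C -> C :=
  fun z => C_derive (fun w => G (w, snd z)) (fst z).
Definition d2 (G : C * C -> C) : C * C -> C :=
  fun z => C_derive (fun w => G (fst z, w)) (snd z).

Definition pderiv (F : C * C -> C) (p q : nat) : C * C -> C :=
  Nat.iter q d2 (Nat.iter p d1 F).

Definition analytic_bidisc (F : C * C -> C) : Prop :=
  forall z, bidisc z ->
    continuous F z /\
    ex_derive (fun w => F (w, snd z)) (fst z) /\
    ex_derive (fun w => F (fst z, w)) (snd z).

Definition admissible_L (beta : R) (l1 l2 : C * C -> R) : Prop :=
  forall z, bidisc z ->
    continuous l1 z /\ continuous l2 z /\
    0 <= l1 z /\ 0 <= l2 z /\
    l1 z > beta / (1 - Cmod (fst z)) /\ l2 z > beta / (1 - Cmod (snd z)).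

Definition lambda_bounds (beta : R) (l1 l2 lj : C * C -> R) : Prop :=
  forall r1 r2, 0 <= r1 <= beta -> 0 <= r2 <= beta ->
    (exists c, 0 < c /\ forall z0 z, bidisc z0 -> bidisc z ->
        cpolydisc z0 (r1 / l1 z0) (r2 / l2 z0) z -> c <= lj z / lj z0) /\
    (exists C, forall z0 z, bidisc z0 -> bidisc z ->
        cpolydisc z0 (r1 / l1 z0) (r2 / l2 z0) z -> lj z / lj z0 <= C).

Definition in_Q2 (beta : R) (l1 l2 : C * C -> R) : Prop :=
  admissible_L beta l1 l2 /\ lambda_bounds beta l1 l2 l1 /\ lambda_bounds beta l1 l2 l2.

Definition nder (F : C * C -> C) (l1 l2 : C * C -> R) (k1 k2 : nat) (z : C * C) : R :=
  Cmod (pderiv F k1 k2 z) / (INR (fact k1) * INR (fact k2) * l1 z ^ k1 * l2 z ^ k2).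

Definition bounded_L_index (F : C * C -> C) (l1 l2 : C * C -> R) : Prop :=
  exists n0 : nat, forall z, bidisc z -> forall p1 p2 : nat,
    exists k1 k2 : nat, (k1 + k2 <= n0)%nat /\
      nder F l1 l2 p1 p2 z <= nder F l1 l2 k1 k2 z.

(* Main.v *)
(* Cauchy's formulas on circles come from Goursat's theorem applied to [f (a + e^w)] on rectangles in
   [w]; they show that the partial derivatives of a continuous, separately holomorphic function stay in
   that class and commute, and give [|F^(p,q)(z)| r1^p r2^q / (p! q!) <= max |F|] on polydiscs.

   If the local bound holds for [R = (beta, beta)], this inequality bounds the normalized derivative of
   order [(p, q)] at [z0] by [p0 beta^-(p+q)] times the one of order [k0], so [beta > 1] gives bounded
   index. Conversely, freeze the weights at [z0]: along the axis-parallel legs from [z0] to [z], the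
   index bound turns the normalized derivatives of order at most [N] in each variable into a finite
   system with [|a_i'| <= K max_j |a_j|], and Gronwall's inequality bounds them by their values at [z0]. *)
From Stdlib Require Import Reals Lra Lia Arith Factorial List Classical ClassicalEpsilon FunctionalExtensionality.
From Coquelicot Require Import Coquelicot.
(* [Reals] also exports a [d1], so [Defs] has to come last. *)
Require Import Defs.
Open Scope R_scope.

(** Nothing is assumed about the regularity of the partial derivatives. Hence Goursat's subdivision,
    and hence integral representations before a derivative can be differentiated again. Rectangles
    suffice because [w -> a + e^w] wraps a vertical segment of length [2 pi] onto a circle.

    Uniformity in [z0] comes from scaling. The condition [l_j > beta / (1 - |z_j|)] keeps the
    polydisc of radii [beta / l_j(z0)] inside the bidisc, and [Q^2] bounds [l_j(z) / l_j(z0)] on it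
    from both sides by constants independent of [z0]. The weights are merely continuous and cannot
    be differentiated along a leg; this is why they are frozen, and the two-sided bound is the price
    of freezing and unfreezing them. Differentiating a frozen normalized derivative brings out a
    factor [l_j(z0)], while a leg has length at most [beta / l_j(z0)]; the product no longer depends
    on [z0], and so neither does the Gronwall constant. The system closes because a derivative one
    step outside the finite family is dominated, by the index bound, by one of total order at most
    [N]. *)

(** * Continuity of complex-valued functions *)

Lemma continuous_C_iff {U : UniformSpace} (f : U -> C) (x : U) :
  continuous f x <->
  forall eps, 0 < eps -> locally x (fun y => Cmod (f y - f x)%C < eps).
Proof.
  split.
  - intros H eps He. apply (H (fun w => Cmod (w - f x)%C < eps)).
    (* The uniform structure of [C] is the product one; its balls compare with the modulus up to a
       factor [sqrt 2], which halving [eps] absorbs. *)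
    exists (mkposreal (eps / 2) ltac:(lra)). intros y Hy.
    apply C_NormedModule_mixin_compat2 in Hy. simpl in Hy.
    apply Rlt_le_trans with (1 := Hy).
    assert (H2 : sqrt 2 <= 2).
    { rewrite <- (sqrt_square 2) at 2 by lra. apply sqrt_le_1; lra. }
    apply Rle_trans with (2 * (eps / 2)); [apply Rmult_le_compat_r; lra | lra].
  - intros H P [e He]. destruct e as [e Hpos]. specialize (H e Hpos).
    unfold filtermap. apply filter_imp with (2 := H). intros y Hy. apply He.
    now apply (C_NormedModule_mixin_compat1 (f x) (f y) e).
Qed.

Lemma continuous_C_pair {U : UniformSpace} (f g : U -> R) (x : U) :
  continuous f x -> continuous g x -> continuous (fun y => (f y, g y) : C) x.
Proof.
  intros Hf Hg P [e He]. unfold filtermap.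
  assert (Lf : locally x (fun y => ball (f x) e (f y))) by (apply Hf; exists e; trivial).
  assert (Lg : locally x (fun y => ball (g x) e (g y))) by (apply Hg; exists e; trivial).
  apply filter_imp with (2 := filter_and _ _ Lf Lg). intros y [Hy1 Hy2].
  apply He. now split.
Qed.

Lemma continuous_Re {U : UniformSpace} (f : U -> C) (x : U) :
  continuous f x -> continuous (fun y => fst (f y)) x.
Proof. intros H. apply (continuous_comp f fst x H). apply continuous_fst. Qed.

Lemma continuous_Im {U : UniformSpace} (f : U -> C) (x : U) :
  continuous f x -> continuous (fun y => snd (f y)) x.
Proof. intros H. apply (continuous_comp f snd x H). apply continuous_snd. Qed.

Lemma continuous_Cplus {U : UniformSpace} (f g : U -> C) (x : U) :
  continuous f x -> continuous g x -> continuous (fun y => f y + g y)%C x.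
Proof. exact (@continuous_plus U R_AbsRing C_R_NormedModule f g x). Qed.

Lemma continuous_Cminus {U : UniformSpace} (f g : U -> C) (x : U) :
  continuous f x -> continuous g x -> continuous (fun y => f y - g y)%C x.
Proof. exact (@continuous_minus U R_AbsRing C_R_NormedModule f g x). Qed.

Lemma continuous_Cmult {U : UniformSpace} (f g : U -> C) (x : U) :
  continuous f x -> continuous g x -> continuous (fun y => f y * g y)%C x.
Proof.
  intros Hf Hg.
  pose proof (continuous_Re f x Hf). pose proof (continuous_Im f x Hf).
  pose proof (continuous_Re g x Hg). pose proof (continuous_Im g x Hg).
  apply continuous_C_pair.
  - apply (continuous_minus (V := R_NormedModule)); now apply (continuous_mult (K := R_AbsRing)).
  - apply (continuous_plus (V := R_NormedModule)); now apply (continuous_mult (K := R_AbsRing)).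
Qed.

(** * Integrals of complex-valued functions on a segment *)

(** Taken componentwise, so that each property reduces to the real Riemann integral. [RInt] is
    total, hence the continuity hypotheses [cont_on] in the rules below, which supply
    integrability. *)
Definition cint (f : R -> C) (a b : R) : C :=
  (RInt (fun t => fst (f t)) a b, RInt (fun t => snd (f t)) a b).

Definition cont_on (f : R -> C) (a b : R) : Prop :=
  forall t, a <= t <= b -> continuous f t.

Lemma cont_on_ex_Re f a b : a <= b -> cont_on f a b -> ex_RInt (fun t => fst (f t)) a b.
Proof.
  intros Hab H. apply (ex_RInt_continuous (V := R_CompleteNormedModule)).
  intros t Ht. rewrite Rmin_left, Rmax_right in Ht by lra.
  now apply continuous_Re, H.
Qed.

Lemma cont_on_ex_Im f a b : a <= b -> cont_on f a b -> ex_RInt (fun t => snd (f t)) a b.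
Proof.
  intros Hab H. apply (ex_RInt_continuous (V := R_CompleteNormedModule)).
  intros t Ht. rewrite Rmin_left, Rmax_right in Ht by lra.
  now apply continuous_Im, H.
Qed.

Lemma cint_ext f g a b :
  a <= b -> (forall t, a <= t <= b -> f t = g t) -> cint f a b = cint g a b.
Proof.
  intros Hab H. unfold cint. f_equal; apply RInt_ext; intros t Ht;
    rewrite Rmin_left, Rmax_right in Ht by lra; rewrite H; trivial; lra.
Qed.

Lemma cint_plus f g a b :
  a <= b -> cont_on f a b -> cont_on g a b ->
  cint (fun t => f t + g t)%C a b = (cint f a b + cint g a b)%C.
Proof.
  intros Hab Hf Hg. unfold cint, Cplus; simpl. f_equal.
  - apply (RInt_plus (fun t => fst (f t)) (fun t => fst (g t))); now apply cont_on_ex_Re.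
  - apply (RInt_plus (fun t => snd (f t)) (fun t => snd (g t))); now apply cont_on_ex_Im.
Qed.

Lemma cint_Cmult (l : C) f a b :
  a <= b -> cont_on f a b -> cint (fun t => l * f t)%C a b = (l * cint f a b)%C.
Proof.
  intros Hab Hf.
  pose proof (cont_on_ex_Re f a b Hab Hf) as H1.
  pose proof (cont_on_ex_Im f a b Hab Hf) as H2.
  unfold cint, Cmult; simpl. f_equal; apply is_RInt_unique.
  - apply (is_RInt_minus (V := R_NormedModule) (fun t => fst l * fst (f t)) (fun t => snd l * snd (f t)));
    apply (is_RInt_scal (V := R_NormedModule)); now apply (RInt_correct (V := R_CompleteNormedModule)).
  - apply (is_RInt_plus (V := R_NormedModule) (fun t => fst l * snd (f t)) (fun t => snd l * fst (f t)));
    apply (is_RInt_scal (V := R_NormedModule)); now apply (RInt_correct (V := R_CompleteNormedModule)).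
Qed.

Lemma cint_minus f g a b :
  a <= b -> cont_on f a b -> cont_on g a b ->
  cint (fun t => f t - g t)%C a b = (cint f a b - cint g a b)%C.
Proof.
  intros Hab Hf Hg. unfold cint, Cminus, Cplus, Copp; simpl. f_equal.
  - apply (RInt_minus (V := R_CompleteNormedModule) (fun t => fst (f t)) (fun t => fst (g t))); now apply cont_on_ex_Re.
  - apply (RInt_minus (V := R_CompleteNormedModule) (fun t => snd (f t)) (fun t => snd (g t))); now apply cont_on_ex_Im.
Qed.

Lemma cint_const (l : C) a b : cint (fun _ => l) a b = (RtoC (b - a) * l)%C.
Proof.
  unfold cint. rewrite !RInt_const. unfold Cmult, RtoC, scal; simpl; unfold mult; simpl.
  f_equal; ring.
Qed.

Lemma cint_Chasles f a m b :
  a <= m <= b -> cont_on f a b -> cint f a b = (cint f a m + cint f m b)%C.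
Proof.
  intros Hm Hf.
  assert (H1 : cont_on f a m) by (intros t Ht; apply Hf; lra).
  assert (H2 : cont_on f m b) by (intros t Ht; apply Hf; lra).
  unfold cint, Cplus; simpl. f_equal; symmetry.
  - apply (RInt_Chasles (V := R_CompleteNormedModule)); apply cont_on_ex_Re; trivial; lra.
  - apply (RInt_Chasles (V := R_CompleteNormedModule)); apply cont_on_ex_Im; trivial; lra.
Qed.

(** Bounding the two components separately would lose a factor; the pair is therefore viewed as one
    integral in the normed module [C_R_NormedModule], whose norm is the modulus. *)
Lemma cint_Cmod_le f a b M :
  a <= b -> cont_on f a b -> (forall t, a <= t <= b -> Cmod (f t) <= M) ->
  Cmod (cint f a b) <= (b - a) * M.
Proof.
  intros Hab Hf HM.
  assert (Hi : is_RInt (V := C_R_NormedModule) f a b (cint f a b)).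
  { apply (is_RInt_fct_extend_pair (U := R_NormedModule) (V := R_NormedModule));
      apply (RInt_correct (V := R_CompleteNormedModule)).
    - now apply cont_on_ex_Re.
    - now apply cont_on_ex_Im. }
  rewrite Cmod_norm. apply (norm_RInt_le_const (V := C_R_NormedModule) f a b _ M Hab); [|exact Hi].
  intros t Ht. rewrite <- Cmod_norm. now apply HM.
Qed.

(** * Derivatives in a real and in a complex variable *)

Definition rder (f : R -> C) (t : R) (v : C) : Prop :=
  is_derive (fun s => fst (f s)) t (fst v) /\ is_derive (fun s => snd (f s)) t (snd v).

(** Complex differentiability at one point, written with [Cmod] so that estimates apply directly;
    [cder_is_derive] identifies it with Coquelicot's notion. *)
Definition cder (f : C -> C) (z l : C) : Prop :=
  forall eps, 0 < eps -> exists delta, 0 < delta /\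
    forall w, Cmod (w - z)%C < delta ->
      Cmod (f w - f z - l * (w - z))%C <= eps * Cmod (w - z)%C.

Lemma cint_rder f df a b :
  a <= b -> (forall t, a <= t <= b -> rder f t (df t)) -> cont_on df a b ->
  cint df a b = (f b - f a)%C.
Proof.
  intros Hab Hf Hc. unfold cint.
  unfold Cminus, Cplus, Copp; simpl. f_equal; apply is_RInt_unique.
  - apply (is_RInt_derive (V := R_CompleteNormedModule) (fun t => fst (f t)) (fun t => fst (df t)));
      intros t Ht; rewrite Rmin_left, Rmax_right in Ht by lra.
    + now apply Hf.
    + now apply continuous_Re, Hc.
  - apply (is_RInt_derive (V := R_CompleteNormedModule) (fun t => snd (f t)) (fun t => snd (df t)));
      intros t Ht; rewrite Rmin_left, Rmax_right in Ht by lra.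
    + now apply Hf.
    + now apply continuous_Im, Hc.
Qed.

Lemma cder_is_derive f z l : cder f z l <-> is_derive (V := C_NormedModule) f z l.
Proof.
  split.
  - intros H. split.
    { apply is_linear_scal_l. }
    intros x Hx eps.
    apply (is_filter_lim_locally_unique (K := C_AbsRing) (V := AbsRing_NormedModule C_AbsRing)) in Hx.
    subst x. destruct (H eps (cond_pos eps)) as [d [Hd Hw]].
    exists (mkposreal d Hd). intros w Hball. specialize (Hw w Hball).
    change (Cmod (f w - f z - (w - z) * l)%C <= eps * Cmod (w - z)%C).
    now rewrite (Cmult_comm (w - z)%C l).
  - intros [_ H] eps He.
    destruct (H z (fun P HP => HP) (mkposreal eps He)) as [d Hd].
    exists d; split; [apply cond_pos|]. intros w Hw. specialize (Hd w Hw).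
    rewrite (Cmult_comm l (w - z)%C). exact Hd.
Qed.

Lemma cder_C_derive f z l : cder f z l -> C_derive f z = l.
Proof. intros H. apply is_C_derive_unique. now apply cder_is_derive. Qed.

Lemma ex_derive_cder f z :
  ex_derive (V := C_NormedModule) f z -> cder f z (C_derive f z).
Proof.
  intros [l Hl]. apply cder_is_derive in Hl. now rewrite (cder_C_derive _ _ _ Hl).
Qed.

Lemma Cmod_lt_locally (z : C) delta :
  0 < delta -> locally z (fun w : C => Cmod (w - z)%C < delta).
Proof. intros Hd. exact (proj1 (continuous_C_iff (fun w : C => w) z) (continuous_id z) delta Hd). Qed.

Lemma locally_C_Cmod (z : C) (P : C -> Prop) :
  locally z P -> exists delta, 0 < delta /\ forall w, Cmod (w - z)%C < delta -> P w.
Proof.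
  intros [d Hd]. exists d; split; [apply cond_pos|]. intros w Hw. apply Hd.
  now apply (C_NormedModule_mixin_compat1 z w d).
Qed.

Lemma cder_continuous f z l : cder f z l -> continuous f z.
Proof.
  intros H. apply continuous_C_iff. intros eps He.
  destruct (H 1 Rlt_0_1) as [d [Hd Hw]].
  pose proof (Cmod_ge_0 l) as Hl.
  assert (Hm : 0 < Rmin d (eps / (1 + Cmod l))).
  { apply Rmin_pos; trivial. apply Rdiv_lt_0_compat; lra. }
  apply filter_imp with (2 := Cmod_lt_locally z _ Hm). intros w Hlt.
  assert (H1 : Cmod (w - z)%C < d) by (eapply Rlt_le_trans; [exact Hlt | apply Rmin_l]).
  assert (H2 : Cmod (w - z)%C < eps / (1 + Cmod l)) by (eapply Rlt_le_trans; [exact Hlt | apply Rmin_r]).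
  specialize (Hw w H1).
  replace (f w - f z)%C with ((f w - f z - l * (w - z)) + l * (w - z))%C by ring.
  eapply Rle_lt_trans; [apply Cmod_triangle|]. rewrite Cmod_mult.
  apply Rlt_div_r in H2; [|lra]. lra.
Qed.

Lemma cder_ext_loc f g z l :
  locally z (fun w : C => f w = g w) -> cder f z l -> cder g z l.
Proof.
  intros Hloc H eps He. destruct (H eps He) as [d [Hd Hw]].
  destruct (locally_C_Cmod _ _ Hloc) as [d' [Hd' Hw']].
  exists (Rmin d d'); split; [now apply Rmin_pos|]. intros w Hlt.
  rewrite <- !Hw'.
  - apply Hw. eapply Rlt_le_trans; [exact Hlt | apply Rmin_l].
  - replace (z - z)%C with (RtoC 0) by (ring). now rewrite Cmod_0.
  - eapply Rlt_le_trans; [exact Hlt | apply Rmin_r].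
Qed.

Lemma cder_const (c z : C) : cder (fun _ => c) z 0.
Proof.
  intros eps He. exists 1; split; [lra|]. intros w _.
  replace (c - c - 0 * (w - z))%C with (RtoC 0) by (ring). rewrite Cmod_0.
  apply Rmult_le_pos; [lra | apply Cmod_ge_0].
Qed.

Lemma cder_id (z : C) : cder (fun w => w) z 1.
Proof.
  intros eps He. exists 1; split; [lra|]. intros w _.
  replace (w - z - 1 * (w - z))%C with (RtoC 0) by ring. rewrite Cmod_0.
  apply Rmult_le_pos; [lra | apply Cmod_ge_0].
Qed.

Lemma cder_plus f g z l m :
  cder f z l -> cder g z m -> cder (fun w => f w + g w)%C z (l + m)%C.
Proof.
  intros Hf Hg eps He.
  destruct (Hf (eps / 2) ltac:(lra)) as [d [Hd Hw]].
  destruct (Hg (eps / 2) ltac:(lra)) as [d' [Hd' Hw']].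
  exists (Rmin d d'); split; [now apply Rmin_pos|]. intros w Hlt.
  specialize (Hw w (Rlt_le_trans _ _ _ Hlt (Rmin_l _ _))).
  specialize (Hw' w (Rlt_le_trans _ _ _ Hlt (Rmin_r _ _))).
  replace (f w + g w - (f z + g z) - (l + m) * (w - z))%C
    with ((f w - f z - l * (w - z)) + (g w - g z - m * (w - z)))%C by ring.
  eapply Rle_trans; [apply Cmod_triangle|]. lra.
Qed.

Lemma cder_mult f g z l m :
  cder f z l -> cder g z m -> cder (fun w => f w * g w)%C z (l * g z + f z * m)%C.
Proof.
  intros Hf Hg eps He.
  pose proof (cder_continuous _ _ _ Hg) as Cg.
  set (K := 1 + Cmod (g z) + Cmod (f z) + Cmod l).
  pose proof (Cmod_ge_0 (g z)). pose proof (Cmod_ge_0 (f z)). pose proof (Cmod_ge_0 l).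
  assert (HK : 0 < K) by (unfold K; lra).
  set (e := eps / (3 * K)).
  assert (He' : 0 < e) by (apply Rdiv_lt_0_compat; lra).
  assert (HeK : e * K * 3 = eps) by (unfold e; field; lra).
  (* The bound [e] makes [g w - g z] small, and the bound [1] keeps [Cmod (g w)] below [K]. *)
  set (e1 := Rmin e 1).
  assert (He1 : 0 < e1) by (apply Rmin_pos; lra).
  destruct (Hf e He') as [d [Hd Hw]].
  destruct (Hg e He') as [d' [Hd' Hw']].
  destruct (locally_C_Cmod _ _ (proj1 (continuous_C_iff _ _) Cg e1 He1)) as [d2 [Hd2 Hw2]].
  exists (Rmin d (Rmin d' d2)); split; [repeat apply Rmin_pos; trivial|]. intros w Hlt.
  specialize (Hw w (Rlt_le_trans _ _ _ Hlt (Rmin_l _ _))).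
  assert (Hlt2 := Rlt_le_trans _ _ _ Hlt (Rmin_r _ _)).
  specialize (Hw' w (Rlt_le_trans _ _ _ Hlt2 (Rmin_l _ _))).
  specialize (Hw2 w (Rlt_le_trans _ _ _ Hlt2 (Rmin_r _ _))).
  assert (Hg1 : Cmod (g w) <= 1 + Cmod (g z)).
  { replace (g w) with ((g w - g z) + g z)%C by ring.
    eapply Rle_trans; [apply Cmod_triangle|]. pose proof (Rmin_r e 1). fold e1 in H2. lra. }
  assert (Hge : Cmod (g w - g z)%C <= e) by (pose proof (Rmin_l e 1) as H2; fold e1 in H2; lra).
  replace (f w * g w - f z * g z - (l * g z + f z * m) * (w - z))%C
    with ((f w - f z - l * (w - z)) * g w + (l * (g w - g z) * (w - z)
          + f z * (g w - g z - m * (w - z))))%C by ring.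
  pose proof (Cmod_ge_0 (w - z)%C) as Hx.
  eapply Rle_trans; [apply Cmod_triangle|].
  eapply Rle_trans; [apply Rplus_le_compat_l, Cmod_triangle|].
  rewrite !Cmod_mult.
  set (x := Cmod (w - z)%C) in *.
  pose proof (Cmod_ge_0 (g w)).
  assert (A1 : Cmod (f w - f z - l * (w - z))%C * Cmod (g w) <= e * x * K).
  { apply Rmult_le_compat; try apply Cmod_ge_0; trivial. unfold K; lra. }
  assert (A2 : Cmod l * Cmod (g w - g z)%C * x <= K * e * x).
  { apply Rmult_le_compat_r; trivial. apply Rmult_le_compat; try apply Cmod_ge_0; trivial. unfold K; lra. }
  assert (A3 : Cmod (f z) * Cmod (g w - g z - m * (w - z))%C <= K * (e * x)).
  { apply Rmult_le_compat; try apply Cmod_ge_0; trivial. unfold K; lra. }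
  rewrite <- HeK. lra.
Qed.

Lemma cder_comp f g z l m :
  cder g z m -> cder f (g z) l -> cder (fun w => f (g w)) z (l * m)%C.
Proof.
  intros Hg Hf eps He.
  pose proof (Cmod_ge_0 l). pose proof (Cmod_ge_0 m).
  set (e1 := eps / (2 * (1 + Cmod m))).
  assert (He1 : 0 < e1) by (apply Rdiv_lt_0_compat; lra).
  assert (E1 : e1 * (1 + Cmod m) * 2 = eps) by (unfold e1; field; lra).
  (* The minimum with [1] makes [g] Lipschitz at [z] with constant [1 + Cmod m]; the other bound
     pays for the remainder of [g] multiplied by [l]. *)
  set (e2 := Rmin 1 (eps / (2 * (1 + Cmod l)))).
  assert (He2 : 0 < e2) by (apply Rmin_pos; [lra|apply Rdiv_lt_0_compat; lra]).
  assert (E2 : e2 * (1 + Cmod l) * 2 <= eps).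
  { pose proof (Rmin_r 1 (eps / (2 * (1 + Cmod l)))) as HH; fold e2 in HH.
    apply Rle_div_r in HH; lra. }
  assert (E3 : e2 <= 1) by apply Rmin_l.
  destruct (Hf e1 He1) as [d [Hd Hw]].
  destruct (Hg e2 He2) as [d' [Hd' Hw']].
  destruct (locally_C_Cmod _ _ (proj1 (continuous_C_iff _ _) (cder_continuous _ _ _ Hg) d Hd)) as [d2 [Hd2 Hw2]].
  exists (Rmin d' d2); split; [repeat apply Rmin_pos; trivial|]. intros w Hlt.
  specialize (Hw' w (Rlt_le_trans _ _ _ Hlt (Rmin_l _ _))).
  specialize (Hw2 w (Rlt_le_trans _ _ _ Hlt (Rmin_r _ _))).
  specialize (Hw (g w) Hw2).
  replace (f (g w) - f (g z) - l * m * (w - z))%C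
    with ((f (g w) - f (g z) - l * (g w - g z)) + l * (g w - g z - m * (w - z)))%C by ring.
  eapply Rle_trans; [apply Cmod_triangle|]. rewrite Cmod_mult.
  assert (Hgw : Cmod (g w - g z)%C <= (1 + Cmod m) * Cmod (w - z)%C).
  { replace (g w - g z)%C with ((g w - g z - m * (w - z)) + m * (w - z))%C by ring.
    eapply Rle_trans; [apply Cmod_triangle|]. rewrite Cmod_mult.
    pose proof (Cmod_ge_0 (w - z)%C). nra. }
  pose proof (Cmod_ge_0 (w - z)%C) as Hx. set (x := Cmod (w - z)%C) in *.
  assert (A1 : e1 * Cmod (g w - g z)%C <= e1 * ((1 + Cmod m) * x)) by (apply Rmult_le_compat_l; lra).
  assert (A2 : Cmod l * Cmod (g w - g z - m * (w - z))%C <= (1 + Cmod l) * (e2 * x)).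
  { apply Rmult_le_compat; try apply Cmod_ge_0; trivial; lra. }
  assert (A3 : e2 * (1 + Cmod l) * 2 * x <= eps * x) by (apply Rmult_le_compat_r; lra).
  rewrite <- E1 in A3 |- *. lra.
Qed.

Lemma Cmod_le_sum (x : C) : Cmod x <= Rabs (fst x) + Rabs (snd x).
Proof.
  replace x with (RtoC (fst x) + Ci * RtoC (snd x))%C at 1.
  - eapply Rle_trans; [apply Cmod_triangle|]. rewrite Cmod_mult, Cmod_Ci, !Cmod_R. lra.
  - destruct x; unfold RtoC, Ci, Cmult, Cplus; simpl; f_equal; ring.
Qed.

Lemma Cmod_Re_le (x : C) : Rabs (fst x) <= Cmod x.
Proof. eapply Rle_trans; [|apply Rmax_Cmod]. apply Rmax_l. Qed.

Lemma Cmod_Im_le (x : C) : Rabs (snd x) <= Cmod x.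
Proof. eapply Rle_trans; [|apply Rmax_Cmod]. apply Rmax_r. Qed.

Lemma is_derive_eps (f : R -> R) (t l : R) :
  is_derive f t l <->
  forall eps, 0 < eps -> exists delta, 0 < delta /\
    forall s, Rabs (s - t) < delta -> Rabs (f s - f t - l * (s - t)) <= eps * Rabs (s - t).
Proof.
  split.
  - intros [_ H] eps He.
    destruct (H t (fun P HP => HP) (mkposreal eps He)) as [d Hd].
    exists d; split; [apply cond_pos|]. intros s Hs. specialize (Hd s Hs).
    rewrite (Rmult_comm l (s - t)). exact Hd.
  - intros H. split; [apply is_linear_scal_l|].
    intros x Hx eps.
    apply (is_filter_lim_locally_unique (K := R_AbsRing) (V := R_NormedModule)) in Hx.
    subst x. destruct (H eps (cond_pos eps)) as [d [Hd Hw]].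
    exists (mkposreal d Hd). intros s Hball. specialize (Hw s Hball).
    change (Rabs (f s - f t - (s - t) * l) <= eps * Rabs (s - t)).
    now rewrite (Rmult_comm (s - t) l).
Qed.

Lemma rder_eps (f : R -> C) (t : R) (v : C) :
  rder f t v <->
  forall eps, 0 < eps -> exists delta, 0 < delta /\
    forall s, Rabs (s - t) < delta ->
      Cmod (f s - f t - v * RtoC (s - t))%C <= eps * Rabs (s - t).
Proof.
  assert (E1 : forall s, fst (f s - f t - v * RtoC (s - t))%C = fst (f s) - fst (f t) - fst v * (s - t)).
  { intros s; simpl; ring. }
  assert (E2 : forall s, snd (f s - f t - v * RtoC (s - t))%C = snd (f s) - snd (f t) - snd v * (s - t)).
  { intros s; simpl; ring. }
  unfold rder. rewrite !is_derive_eps. split.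
  - intros [H1 H2] eps He.
    destruct (H1 (eps / 2) ltac:(lra)) as [d [Hd Hw]].
    destruct (H2 (eps / 2) ltac:(lra)) as [d' [Hd' Hw']].
    exists (Rmin d d'); split; [now apply Rmin_pos|]. intros s Hlt.
    specialize (Hw s (Rlt_le_trans _ _ _ Hlt (Rmin_l _ _))).
    specialize (Hw' s (Rlt_le_trans _ _ _ Hlt (Rmin_r _ _))).
    eapply Rle_trans; [apply Cmod_le_sum|]. rewrite E1, E2. lra.
  - intros H; split; intros eps He; destruct (H eps He) as [d [Hd Hw]];
    exists d; split; trivial; intros s Hs.
    + rewrite <- E1. eapply Rle_trans; [apply Cmod_Re_le | now apply Hw].
    + rewrite <- E2. eapply Rle_trans; [apply Cmod_Im_le | now apply Hw].
Qed.

Lemma rder_continuous f t v : rder f t v -> continuous f t.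
Proof.
  intros [H1 H2].
  apply (continuous_ext (fun s => (fst (f s), snd (f s)) : C)).
  { intros s; now destruct (f s). }
  apply continuous_C_pair.
  - apply (ex_derive_continuous (K := R_AbsRing) (V := R_NormedModule)). now exists (fst v).
  - apply (ex_derive_continuous (K := R_AbsRing) (V := R_NormedModule)). now exists (snd v).
Qed.

Lemma cder_rder_comp f (g : R -> C) t l v :
  rder g t v -> cder f (g t) l -> rder (fun s => f (g s)) t (l * v)%C.
Proof.
  intros Hg Hf. pose proof (rder_continuous _ _ _ Hg) as Cg.
  rewrite rder_eps in Hg |- *. intros eps He.
  pose proof (Cmod_ge_0 l). pose proof (Cmod_ge_0 v).
  set (e1 := eps / (2 * (1 + Cmod v))).
  assert (He1 : 0 < e1) by (apply Rdiv_lt_0_compat; lra).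
  assert (E1 : e1 * (1 + Cmod v) * 2 = eps) by (unfold e1; field; lra).
  set (e2 := Rmin 1 (eps / (2 * (1 + Cmod l)))).
  assert (He2 : 0 < e2) by (apply Rmin_pos; [lra|apply Rdiv_lt_0_compat; lra]).
  assert (E2 : e2 * (1 + Cmod l) * 2 <= eps).
  { pose proof (Rmin_r 1 (eps / (2 * (1 + Cmod l)))) as HH; fold e2 in HH.
    apply Rle_div_r in HH; lra. }
  assert (E3 : e2 <= 1) by apply Rmin_l.
  destruct (Hf e1 He1) as [d [Hd Hw]].
  destruct (Hg e2 He2) as [d' [Hd' Hw']].
  destruct (proj1 (continuous_C_iff _ _) Cg d Hd) as [d2 Hw2].
  exists (Rmin d' d2); split; [repeat apply Rmin_pos; trivial; apply cond_pos|]. intros w Hlt.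
  specialize (Hw' w (Rlt_le_trans _ _ _ Hlt (Rmin_l _ _))).
  specialize (Hw2 w (Rlt_le_trans _ _ _ Hlt (Rmin_r _ _))).
  specialize (Hw (g w) Hw2).
  replace (f (g w) - f (g t) - l * v * RtoC (w - t))%C
    with ((f (g w) - f (g t) - l * (g w - g t)) + l * (g w - g t - v * RtoC (w - t)))%C by ring.
  eapply Rle_trans; [apply Cmod_triangle|]. rewrite Cmod_mult.
  pose proof (Rabs_pos (w - t)) as Hx.
  assert (Hgw : Cmod (g w - g t)%C <= (1 + Cmod v) * Rabs (w - t)).
  { replace (g w - g t)%C with ((g w - g t - v * RtoC (w - t)) + v * RtoC (w - t))%C by ring.
    eapply Rle_trans; [apply Cmod_triangle|]. rewrite Cmod_mult, Cmod_R. nra. }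
  set (x := Rabs (w - t)) in *.
  assert (A1 : e1 * Cmod (g w - g t)%C <= e1 * ((1 + Cmod v) * x)) by (apply Rmult_le_compat_l; lra).
  assert (A2 : Cmod l * Cmod (g w - g t - v * RtoC (w - t))%C <= (1 + Cmod l) * (e2 * x)).
  { apply Rmult_le_compat; try apply Cmod_ge_0; trivial; lra. }
  assert (A3 : e2 * (1 + Cmod l) * 2 * x <= eps * x) by (apply Rmult_le_compat_r; lra).
  rewrite <- E1 in A3 |- *. lra.
Qed.

Lemma rder_mult (f g : R -> C) t v w :
  rder f t v -> rder g t w -> rder (fun s => f s * g s)%C t (v * g t + f t * w)%C.
Proof.
  intros [F1 F2] [G1 G2]. split; simpl.
  - replace (fst v * fst (g t) - snd v * snd (g t) + (fst (f t) * fst w - snd (f t) * snd w))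
      with (minus (fst v * fst (g t) + fst (f t) * fst w) (snd v * snd (g t) + snd (f t) * snd w))
      by (unfold minus, plus, opp; simpl; ring).
    apply (is_derive_minus (V := R_NormedModule) (fun s => fst (f s) * fst (g s)) (fun s => snd (f s) * snd (g s)));
    apply (is_derive_mult (K := R_AbsRing)); trivial; exact Rmult_comm.
  - replace (fst v * snd (g t) + snd v * fst (g t) + (fst (f t) * snd w + snd (f t) * fst w))
      with (plus (fst v * snd (g t) + fst (f t) * snd w) (snd v * fst (g t) + snd (f t) * fst w))
      by (unfold plus; simpl; ring).
    apply (is_derive_plus (V := R_NormedModule) (fun s => fst (f s) * snd (g s)) (fun s => snd (f s) * fst (g s)));
    apply (is_derive_mult (K := R_AbsRing)); trivial; exact Rmult_comm.
Qed.

(** * Goursat's theorem on rectangles *)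

(** The contour integral of [G] along the counterclockwise boundary of [[a, b] x [c, d]], with
    opposite sides paired: bottom minus top, then [i] times right minus left. *)
Definition rect_int (G : C -> C) (a b c d : R) : C :=
  (cint (fun s => G (s, c) - G (s, d)) a b + Ci * cint (fun t => G (b, t) - G (a, t)) c d)%C.

Definition in_rect (a b c d : R) (w : C) : Prop := a <= fst w <= b /\ c <= snd w <= d.

Lemma continuous_horizontal (G : C -> C) (s c : R) :
  continuous G (s, c) -> continuous (fun x => G (x, c)) s.
Proof.
  intros H. apply (continuous_comp (fun x : R => (x, c) : C) G); trivial.
  apply continuous_C_pair; [apply continuous_id | apply continuous_const].
Qed.

Lemma continuous_vertical (G : C -> C) (s c : R) :
  continuous G (s, c) -> continuous (fun x => G (s, x)) c.
Proof.
  intros H. apply (continuous_comp (fun x : R => (s, x) : C) G); trivial.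
  apply continuous_C_pair; [apply continuous_const | apply continuous_id].
Qed.

Lemma cont_on_horizontal (G : C -> C) (a b c d y : R) :
  (forall w, in_rect a b c d w -> continuous G w) ->
  c <= y <= d -> cont_on (fun s => G (s, y)) a b.
Proof. intros HG Hy s Hs. now apply continuous_horizontal, HG; split. Qed.

Lemma cont_on_vertical (G : C -> C) (a b c d x : R) :
  (forall w, in_rect a b c d w -> continuous G w) ->
  a <= x <= b -> cont_on (fun t => G (x, t)) c d.
Proof. intros HG Hx s Hs. now apply continuous_vertical, HG; split. Qed.

Lemma cont_on_horizontal_diff (G : C -> C) (a b c d y y' : R) :
  (forall w, in_rect a b c d w -> continuous G w) ->
  c <= y <= d -> c <= y' <= d -> cont_on (fun s => G (s, y) - G (s, y'))%C a b.
Proof.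
  intros HG Hy Hy' s Hs. apply continuous_Cminus;
  [apply (cont_on_horizontal G a b c d y) | apply (cont_on_horizontal G a b c d y')]; trivial.
Qed.

Lemma cont_on_vertical_diff (G : C -> C) (a b c d x x' : R) :
  (forall w, in_rect a b c d w -> continuous G w) ->
  a <= x <= b -> a <= x' <= b -> cont_on (fun t => G (x, t) - G (x', t))%C c d.
Proof.
  intros HG Hy Hy' s Hs. apply continuous_Cminus;
  [apply (cont_on_vertical G a b c d x) | apply (cont_on_vertical G a b c d x')]; trivial.
Qed.

(** The horizontal sides split at [m], and the vertical segment over [m] is run through once in each
    direction, so its contributions cancel. *)
Lemma rect_int_split_h (G : C -> C) (a b c d m : R) :
  (forall w, in_rect a b c d w -> continuous G w) ->
  a <= m <= b -> c <= d ->
  rect_int G a b c d = (rect_int G a m c d + rect_int G m b c d)%C.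
Proof.
  intros HG Hm Hcd. unfold rect_int.
  rewrite (cint_Chasles _ a m b) by (trivial; apply (cont_on_horizontal_diff G a b c d); trivial; lra).
  rewrite (cint_ext (fun t => G (b, t) - G (a, t))%C
             (fun t => (G (m, t) - G (a, t)) + (G (b, t) - G (m, t)))%C c d) by (trivial; intros; ring).
  rewrite cint_plus by (trivial; apply (cont_on_vertical_diff G a b c d); trivial; lra). ring.
Qed.

Lemma rect_int_split_v (G : C -> C) (a b c d m : R) :
  (forall w, in_rect a b c d w -> continuous G w) ->
  a <= b -> c <= m <= d ->
  rect_int G a b c d = (rect_int G a b c m + rect_int G a b m d)%C.
Proof.
  intros HG Hab Hm. unfold rect_int.
  rewrite (cint_Chasles (fun t => G (b, t) - G (a, t))%C c m d) by (trivial; apply (cont_on_vertical_diff G a b c d); trivial; lra).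
  rewrite (cint_ext (fun s => G (s, c) - G (s, d))%C
             (fun s => (G (s, c) - G (s, m)) + (G (s, m) - G (s, d)))%C a b) by (trivial; intros; ring).
  rewrite cint_plus by (trivial; apply (cont_on_horizontal_diff G a b c d); trivial; lra). ring.
Qed.

(** An affine function has boundary integral zero, so only the remainder counts. It is at most
    [eps * D] in modulus on the rectangle, where [D] is the sum of the side lengths; opposite sides
    then differ by at most [2 * eps * D], and integrating over both pairs of sides gives another
    factor [D]. *)
Lemma rect_int_local (G : C -> C) (a b c d : R) (w0 l : C) (eps : R) :
  (forall w, in_rect a b c d w -> continuous G w) ->
  a <= b -> c <= d -> in_rect a b c d w0 ->
  (forall w, in_rect a b c d w -> Cmod (G w - G w0 - l * (w - w0))%C <= eps * Cmod (w - w0)%C) ->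
  0 <= eps ->
  Cmod (rect_int G a b c d) <= 2 * eps * ((b - a) + (d - c)) ^ 2.
Proof.
  intros HG Hab Hcd Hw0 Hl Heps.
  set (r := fun w => (G w - (l * w))%C).
  set (D := (b - a) + (d - c)).
  assert (Hr : forall w w', in_rect a b c d w -> in_rect a b c d w' -> Cmod (r w - r w')%C <= 2 * eps * D).
  { assert (H1 : forall w, in_rect a b c d w -> Cmod (G w - G w0 - l * (w - w0))%C <= eps * D).
    { intros w Hw. eapply Rle_trans; [now apply Hl|]. apply Rmult_le_compat_l; trivial.
      eapply Rle_trans; [apply Cmod_le_sum|]. simpl. unfold D. destruct Hw, Hw0.
      apply Rplus_le_compat; apply Rabs_le; lra. }
    intros w w' Hw Hw'.
    replace (r w - r w')%C with ((G w - G w0 - l * (w - w0)) + - (G w' - G w0 - l * (w' - w0)))%C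
      by (unfold r; ring).
    eapply Rle_trans; [apply Cmod_triangle|]. rewrite Cmod_opp.
    pose proof (H1 w Hw). pose proof (H1 w' Hw'). lra. }
  assert (Cr : forall w, in_rect a b c d w -> continuous r w).
  { intros w Hw. unfold r. apply continuous_Cminus; [now apply HG|].
    apply continuous_Cmult; [apply continuous_const | apply continuous_id]. }
  assert (Chor : cont_on (fun s => r (s, c) - r (s, d))%C a b).
  { intros s Hs. apply continuous_Cminus; apply continuous_horizontal, Cr; split; simpl; lra. }
  assert (Cver : cont_on (fun t => r (b, t) - r (a, t))%C c d).
  { intros s Hs. apply continuous_Cminus; apply continuous_vertical, Cr; split; simpl; lra. }
  assert (E : rect_int G a b c d =
    (cint (fun s => r (s, c) - r (s, d)) a b + Ci * cint (fun t => r (b, t) - r (a, t)) c d)%C).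
  { unfold rect_int.
    rewrite (cint_ext (fun s => G (s, c) - G (s, d))%C
               (fun s => (r (s, c) - r (s, d)) + l * (Ci * RtoC (c - d)))%C a b); trivial.
    2:{ intros s _. unfold r.
        replace (Ci * RtoC (c - d))%C with (((s, c) : C) - (s, d))%C.
        - ring.
        - unfold Ci, RtoC, Cminus, Cplus, Copp, Cmult; simpl; f_equal; ring. }
    rewrite (cint_ext (fun t => G (b, t) - G (a, t))%C
               (fun t => (r (b, t) - r (a, t)) + l * RtoC (b - a))%C c d); trivial.
    2:{ intros t _. unfold r.
        replace (RtoC (b - a))%C with (((b, t) : C) - (a, t))%C.
        - ring.
        - unfold Ci, RtoC, Cminus, Cplus, Copp, Cmult; simpl; f_equal; ring. }
    rewrite !cint_plus; trivial; try (intros ? _; apply continuous_const).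
    (* The linear part contributes [(b - a) l i (c - d)] and [i (d - c) l (b - a)], which cancel. *)
    rewrite !cint_const, !RtoC_minus. ring. }
  rewrite E. eapply Rle_trans; [apply Cmod_triangle|]. rewrite Cmod_mult, Cmod_Ci.
  assert (B1 : Cmod (cint (fun s => r (s, c) - r (s, d))%C a b) <= (b - a) * (2 * eps * D)).
  { apply cint_Cmod_le; trivial. intros t Ht. apply Hr; split; simpl; lra. }
  assert (B2 : Cmod (cint (fun t => r (b, t) - r (a, t))%C c d) <= (d - c) * (2 * eps * D)).
  { apply cint_Cmod_le; trivial. intros t Ht. apply Hr; split; simpl; lra. }
  replace (2 * eps * D ^ 2) with ((b - a) * (2 * eps * D) + (d - c) * (2 * eps * D)) by (unfold D; ring).
  lra.
Qed.

(** Every left endpoint lies below every right endpoint, so the supremum of the left endpoints is in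
    all the intervals. *)
Lemma nested_halving (x : nat -> R) (h : R) :
  0 <= h ->
  (forall n, x n <= x (S n) /\ x (S n) + h / 2 ^ S n <= x n + h / 2 ^ n) ->
  exists u, forall n, x n <= u <= x n + h / 2 ^ n.
Proof.
  intros Hh Hx.
  assert (Hpos : forall n, 0 <= h / 2 ^ n).
  { intros n. apply Rdiv_le_0_compat; trivial. apply pow_lt; lra. }
  assert (Hmono : forall n m, x n <= x (n + m)%nat /\ x (n + m)%nat + h / 2 ^ (n + m) <= x n + h / 2 ^ n).
  { intros n m. induction m as [|m IH].
    - rewrite Nat.add_0_r. lra.
    - rewrite Nat.add_succ_r. destruct (Hx (n + m)%nat). lra. }
  assert (Hle : forall n m, x m <= x n + h / 2 ^ n).
  { intros n m. destruct (Nat.le_ge_cases n m) as [H|H].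
    - pose proof (Hmono n (m - n)%nat) as [_ H1].
      replace (n + (m - n))%nat with m in H1 by lia. specialize (Hpos m). lra.
    - pose proof (Hmono m (n - m)%nat) as [H1 _].
      replace (m + (n - m))%nat with n in H1 by lia. specialize (Hpos n). lra. }
  destruct (completeness (fun y => exists n, y = x n)) as [u [Hu1 Hu2]].
  - exists (x 0%nat + h / 2 ^ 0). intros y [n ->]. apply Hle.
  - exists (x 0%nat). now exists 0%nat.
  - exists u. intros n. split.
    + apply Hu1. now exists n.
    + apply Hu2. intros y [m ->]. apply Hle.
Qed.

Lemma pow2_inv_small (h delta : R) : 0 <= h -> 0 < delta -> exists n, h / 2 ^ n < delta.
Proof.
  intros Hh Hd.
  destruct (pow_lt_1_zero (/ 2) ltac:(rewrite Rabs_right; lra) (delta / (h + 1))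
             ltac:(apply Rdiv_lt_0_compat; lra)) as [N HN].
  exists N. specialize (HN N (Nat.le_refl N)).
  rewrite Rabs_right in HN by (apply Rle_ge, pow_le; lra).
  rewrite pow_inv in HN. apply Rlt_div_r in HN; [|lra].
  assert (0 < / 2 ^ N) by (apply Rinv_0_lt_compat, pow_lt; lra).
  unfold Rdiv. nra.
Qed.

(** Repeated quartering: each generation keeps a quarter that carries at least one fourth of the
    integral. The kept rectangles shrink to a point at which [G] is differentiable; there the factor
    [4 ^ n] lost in the selection is exactly compensated by the square of the shrinking diameter in
    [rect_int_local], and an arbitrarily small factor remains. *)
Lemma goursat (G : C -> C) (a b c d : R) :
  a <= b -> c <= d ->
  (forall w, in_rect a b c d w -> exists l, cder G w l) ->
  rect_int G a b c d = 0.
Proof.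
  intros Hab Hcd HG.
  set (h := b - a). set (k := d - c).
  assert (Hh : 0 <= h) by (unfold h; lra). assert (Hk : 0 <= k) by (unfold k; lra).
  assert (Cont : forall w, in_rect a b c d w -> continuous G w).
  { intros w Hw. destruct (HG w Hw) as [l Hl]. now apply cder_continuous with l. }
  set (J := fun (n : nat) (p : R * R) =>
    rect_int G (fst p) (fst p + h / 2 ^ n) (snd p) (snd p + k / 2 ^ n)).
  set (inside := fun (n : nat) (p : R * R) =>
    a <= fst p /\ fst p + h / 2 ^ n <= b /\ c <= snd p /\ snd p + k / 2 ^ n <= d).
  set (step := fun (n : nat) (p q : R * R) =>
    fst p <= fst q /\ fst q + h / 2 ^ S n <= fst p + h / 2 ^ n /\
    snd p <= snd q /\ snd q + k / 2 ^ S n <= snd p + k / 2 ^ n /\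
    Cmod (J n p) <= 4 * Cmod (J (S n) q)).
  assert (Half : forall x n, x / 2 ^ n = x / 2 ^ S n + x / 2 ^ S n).
  { intros x n. simpl. field. apply pow_nonzero; lra. }
  assert (Pos : forall x n, 0 <= x -> 0 <= x / 2 ^ n).
  { intros x n Hx. apply Rdiv_le_0_compat; trivial. apply pow_lt; lra. }
  assert (Step : forall n p, inside n p -> exists q, step n p q).
  { intros n p (I1 & I2 & I3 & I4).
    pose proof (Pos h (S n) Hh) as Ph. pose proof (Pos k (S n) Hk) as Pk.
    pose proof (Half h n) as Eh. pose proof (Half k n) as Ek.
    destruct p as [x y]. simpl fst in *; simpl snd in *.
    set (h' := h / 2 ^ S n) in *. set (k' := k / 2 ^ S n) in *.
    assert (Q : J n (x, y) = (J (S n) (x, y) + J (S n) (x, y + k')%R + (J (S n) (x + h', y)%R + J (S n) (x + h', y + k')%R))%C).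
    { unfold J; simpl fst; simpl snd. fold h' k'. rewrite Eh, Ek.
      rewrite (rect_int_split_h G x (x + (h' + h')) y (y + (k' + k'))) with (m := x + h'); try lra.
      2:{ intros w [W1 W2]; apply Cont; split; lra. }
      rewrite (rect_int_split_v G x (x + h') y (y + (k' + k'))) with (m := y + k'); try lra.
      2:{ intros w [W1 W2]; apply Cont; split; lra. }
      rewrite (rect_int_split_v G (x + h') (x + (h' + h')) y (y + (k' + k'))) with (m := y + k'); try lra.
      2:{ intros w [W1 W2]; apply Cont; split; lra. }
      now rewrite <- !Rplus_assoc. }
    assert (T : Cmod (J n (x, y)) <= Cmod (J (S n) (x, y)) + Cmod (J (S n) (x, y + k')%R)
                + (Cmod (J (S n) (x + h', y)%R) + Cmod (J (S n) (x + h', y + k')%R))).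
    { rewrite Q. eapply Rle_trans; [apply Cmod_triangle|].
      apply Rplus_le_compat; apply Cmod_triangle. }
    (* If the first three quarters are each too small, the triangle inequality [T] forces the fourth
       to qualify. *)
    destruct (Rle_dec (Cmod (J n (x, y))) (4 * Cmod (J (S n) (x, y)))) as [H1|H1];
      [exists (x, y)|].
    { unfold step; simpl fst; simpl snd; fold h' k'; repeat split; trivial; lra. }
    destruct (Rle_dec (Cmod (J n (x, y))) (4 * Cmod (J (S n) (x, y + k')%R))) as [H2|H2];
      [exists (x, y + k')|].
    { unfold step; simpl fst; simpl snd; fold h' k'; repeat split; trivial; lra. }
    destruct (Rle_dec (Cmod (J n (x, y))) (4 * Cmod (J (S n) (x + h', y)%R))) as [H3|H3];
      [exists (x + h', y)|exists (x + h', y + k')].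
    { unfold step; simpl fst; simpl snd; fold h' k'; repeat split; trivial; lra. }
    { unfold step; simpl fst; simpl snd; fold h' k'; repeat split; trivial; lra. } }
  (* A good quarter is only known to exist, so the sequence of corners is built with Hilbert's
     epsilon. *)
  set (next := fun n p => epsilon (inhabits p) (step n p)).
  set (corner := fix corner n := match n with O => (a, c) | S m => next m (corner m) end).
  assert (In0 : inside 0%nat (corner 0%nat)).
  { unfold inside, h, k; simpl. lra. }
  assert (Spec : forall n, inside n (corner n) /\ step n (corner n) (corner (S n))).
  { assert (Nx : forall n, inside n (corner n) -> step n (corner n) (corner (S n))).
    { intros n Hn. simpl. unfold next. apply epsilon_spec. now apply Step. }
    intros n. induction n as [|n [IH1 IH2]]; [auto|].
    assert (inside (S n) (corner (S n))); [|auto].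
    destruct IH1 as (?&?&?&?). destruct IH2 as (?&?&?&?&?). unfold inside. lra. }
  destruct (nested_halving (fun n => fst (corner n)) h Hh) as [u Hu].
  { intros n. destruct (Spec n) as [_ (?&?&?&?&?)]. lra. }
  destruct (nested_halving (fun n => snd (corner n)) k Hk) as [v Hv].
  { intros n. destruct (Spec n) as [_ (?&?&?&?&?)]. lra. }
  assert (Hw0 : in_rect a b c d (u, v)).
  { destruct (Spec 0%nat) as [(?&?&?&?) _]. specialize (Hu 0%nat). specialize (Hv 0%nat).
    split; simpl fst; simpl snd; lra. }
  assert (Grow : forall n, Cmod (rect_int G a b c d) <= 4 ^ n * Cmod (J n (corner n))).
  { intros n. induction n as [|n IH].
    - unfold J; simpl fst; simpl snd.
      replace (a + h / 2 ^ 0) with b by (unfold h; simpl; field).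
      replace (c + k / 2 ^ 0) with d by (unfold k; simpl; field). simpl; lra.
    - destruct (Spec n) as [_ (_&_&_&_&H)]. eapply Rle_trans; [exact IH|].
      rewrite <- tech_pow_Rmult, (Rmult_comm 4), Rmult_assoc.
      apply Rmult_le_compat_l; trivial. apply pow_le; lra. }
  destruct (HG _ Hw0) as [l Hl].
  apply Cmod_eq_0. apply Rle_antisym; [|apply Cmod_ge_0].
  apply le_epsilon. intros eps Heps.
  (* The final bound is [2 * (h + k) ^ 2 * e]; the [+ 1] keeps the denominator positive for a
     degenerate rectangle. *)
  set (e := eps / (2 * (h + k) ^ 2 + 1)).
  assert (P2 : 0 <= (h + k) ^ 2) by apply pow2_ge_0.
  assert (He : 0 < e) by (apply Rdiv_lt_0_compat; lra).
  destruct (Hl e He) as [dl [Hdl Hloc]].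
  destruct (pow2_inv_small (h + k) dl ltac:(lra) Hdl) as [n Hn].
  destruct (Spec n) as [(I1 & I2 & I3 & I4) _].
  pose proof (Pos h n Hh) as Ph. pose proof (Pos k n Hk) as Pk.
  specialize (Hu n). specialize (Hv n).
  assert (Bound : Cmod (J n (corner n)) <= 2 * e * ((h / 2 ^ n) + (k / 2 ^ n)) ^ 2).
  { unfold J.
    replace (h / 2 ^ n + k / 2 ^ n) with
      ((fst (corner n) + h / 2 ^ n - fst (corner n)) + (snd (corner n) + k / 2 ^ n - snd (corner n))) by ring.
    apply rect_int_local with (w0 := (u, v) : C) (l := l); try lra.
    - intros w [W1 W2]; apply Cont; split; lra.
    - split; simpl fst; simpl snd; lra.
    - intros w [W1 W2]. apply Hloc. eapply Rle_lt_trans; [apply Cmod_le_sum|].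
      eapply Rle_lt_trans; [|exact Hn].
      replace ((h + k) / 2 ^ n) with (h / 2 ^ n + k / 2 ^ n) by (unfold Rdiv; ring).
      simpl fst; simpl snd. apply Rplus_le_compat; apply Rabs_le; lra. }
  eapply Rle_trans; [apply (Grow n)|].
  apply Rle_trans with (4 ^ n * (2 * e * (h / 2 ^ n + k / 2 ^ n) ^ 2)).
  { apply Rmult_le_compat_l; trivial. apply pow_le; lra. }
  replace (4 ^ n * (2 * e * (h / 2 ^ n + k / 2 ^ n) ^ 2)) with (2 * (h + k) ^ 2 * e).
  - replace (0 + eps) with ((2 * (h + k) ^ 2 + 1) * e) by (unfold e; field; lra). nra.
  - replace 4 with (2 * 2) by ring. rewrite Rpow_mult_distr. field. apply pow_nonzero; lra.
Qed.

(** * The complex exponential and the unit circle *)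

Definition Cexp (w : C) : C := (exp (fst w) * cos (snd w), exp (fst w) * sin (snd w)).

Definition expi (t : R) : C := (cos t, sin t).

Lemma Cexp_expi s t : Cexp (s, t) = (RtoC (exp s) * expi t)%C.
Proof. unfold Cexp, expi, RtoC, Cmult; simpl. f_equal; ring. Qed.

Lemma Cexp_plus w z : Cexp (w + z)%C = (Cexp w * Cexp z)%C.
Proof.
  unfold Cexp, Cmult, Cplus; simpl. rewrite exp_plus, cos_plus, sin_plus. f_equal; ring.
Qed.

Lemma expi_plus s t : expi (s + t) = (expi s * expi t)%C.
Proof. unfold expi, Cmult; simpl. rewrite cos_plus, sin_plus. f_equal; ring. Qed.

Lemma Cmod_expi t : Cmod (expi t) = 1.
Proof.
  unfold Cmod, expi; simpl fst; simpl snd. rewrite <- !Rsqr_pow2, Rplus_comm, sin2_cos2. apply sqrt_1.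
Qed.

Lemma Cmod_Cexp w : Cmod (Cexp w) = exp (fst w).
Proof.
  destruct w as [s t]. rewrite Cexp_expi, Cmod_mult, Cmod_R, Cmod_expi, Rmult_1_r.
  apply Rabs_right. left. apply exp_pos.
Qed.

Lemma expi_opp_l t : (expi (- t) * expi t)%C = 1.
Proof.
  rewrite <- expi_plus, Rplus_opp_l. unfold expi. rewrite cos_0, sin_0. reflexivity.
Qed.

Lemma Cexp_2PI s : Cexp (s, 2 * PI) = Cexp (s, 0).
Proof. unfold Cexp; simpl fst; simpl snd. now rewrite cos_2PI, sin_2PI, cos_0, sin_0. Qed.

Lemma expi_2PI n : expi (INR n * (2 * PI)) = 1.
Proof.
  unfold expi. replace (INR n * (2 * PI)) with (0 + 2 * INR n * PI) by ring.
  rewrite cos_period, sin_period, cos_0, sin_0. reflexivity.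
Qed.

Lemma expi_opp_2PI n : expi (- (INR n * (2 * PI))) = 1.
Proof.
  pose proof (expi_opp_l (INR n * (2 * PI))) as H. rewrite expi_2PI in H.
  rewrite <- H. ring.
Qed.

Lemma Cexp_near_0 eps : 0 < eps -> exists delta, 0 < delta /\
  forall h, Cmod h < delta -> Cmod (Cexp h - 1 - h)%C <= eps * Cmod h.
Proof.
  (* The errors of [exp], [cos] and [sin] add up to [(1 + 2 + 3 + 1) * e * m], whence the [7]; the
     bound [e <= 1] gives [Rabs (exp x) <= 3] and [Rabs (1 + x) <= 2]. *)
  intros Heps. set (e := Rmin 1 (eps / 7)).
  assert (He : 0 < e) by (apply Rmin_pos; lra).
  assert (He7 : 7 * e <= eps) by (pose proof (Rmin_r 1 (eps / 7)) as H; fold e in H; lra).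
  assert (He1 : e <= 1) by apply Rmin_l.
  destruct (proj1 (is_derive_eps exp 0 1) ltac:(rewrite <- exp_0 at 1; apply is_derive_exp) e He)
    as [d1 [Hd1 E1]].
  destruct (proj1 (is_derive_eps cos 0 0) ltac:(auto_derive; trivial; rewrite sin_0; ring) e He)
    as [d2 [Hd2 E2]].
  destruct (proj1 (is_derive_eps sin 0 1) ltac:(auto_derive; trivial; rewrite cos_0; ring) e He)
    as [d3 [Hd3 E3]].
  exists (Rmin (e / 2) (Rmin d1 (Rmin d2 d3))). split; [repeat apply Rmin_pos; trivial; lra|].
  intros [x y] Hh.
  assert (Hx := Cmod_Re_le (x, y)). assert (Hy := Cmod_Im_le (x, y)). simpl fst in *; simpl snd in *.
  set (m := Cmod (x, y)) in *.
  assert (Hm1 := Rlt_le_trans _ _ _ Hh (Rmin_l _ _)).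
  assert (Hh2 := Rlt_le_trans _ _ _ Hh (Rmin_r _ _)).
  assert (Hm2 := Rlt_le_trans _ _ _ Hh2 (Rmin_l _ _)).
  assert (Hh3 := Rlt_le_trans _ _ _ Hh2 (Rmin_r _ _)).
  assert (Hm3 := Rlt_le_trans _ _ _ Hh3 (Rmin_l _ _)).
  assert (Hm4 := Rlt_le_trans _ _ _ Hh3 (Rmin_r _ _)).
  specialize (E1 x). specialize (E2 y). specialize (E3 y).
  rewrite Rminus_0_r in *. rewrite exp_0 in E1. rewrite cos_0 in E2. rewrite sin_0 in E3.
  specialize (E1 ltac:(lra)). specialize (E2 ltac:(lra)). specialize (E3 ltac:(lra)).
  eapply Rle_trans; [apply Cmod_le_sum|].
  unfold Cexp; simpl fst; simpl snd.
  replace (exp x * cos y + - (1) + - x) with ((exp x - 1 - 1 * x) * cos y + (1 + x) * (cos y - 1 - 0 * y)) by ring.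
  replace (exp x * sin y + - 0 + - y) with (exp x * (sin y - 0 - 1 * y) + ((exp x - 1 - 1 * x) + x) * y) by ring.
  assert (Hcos : Rabs (cos y) <= 1) by (apply Rabs_le, COS_bound).
  assert (Hexp : Rabs (exp x) <= 3).
  { replace (exp x) with ((exp x - 1 - 1 * x) + (1 + x)) by ring.
    eapply Rle_trans; [apply Rabs_triang|].
    pose proof (Rabs_triang 1 x). rewrite Rabs_R1 in *. pose proof (Rabs_pos x). nra. }
  assert (Hexp1 : Rabs (exp x - 1 - 1 * x + x) <= e).
  { eapply Rle_trans; [apply Rabs_triang|]. pose proof (Rabs_pos x). nra. }
  assert (Hx1 : Rabs (1 + x) <= 2).
  { eapply Rle_trans; [apply Rabs_triang|]. rewrite Rabs_R1. lra. }
  assert (Hem : e * Rabs x <= e * m) by (apply Rmult_le_compat_l; lra).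
  assert (Hem' : e * Rabs y <= e * m) by (apply Rmult_le_compat_l; lra).
  assert (Hm : 0 <= m) by apply Cmod_ge_0.
  assert (T1 : Rabs ((exp x - 1 - 1 * x) * cos y + (1 + x) * (cos y - 1 - 0 * y)) <= e * m * 1 + 2 * (e * m)).
  { eapply Rle_trans; [apply Rabs_triang|]. rewrite !Rabs_mult.
    apply Rplus_le_compat; apply Rmult_le_compat; try apply Rabs_pos; lra. }
  assert (T2 : Rabs (exp x * (sin y - 0 - 1 * y) + (exp x - 1 - 1 * x + x) * y) <= 3 * (e * m) + e * m).
  { eapply Rle_trans; [apply Rabs_triang|]. rewrite !Rabs_mult.
    apply Rplus_le_compat; apply Rmult_le_compat; try apply Rabs_pos; lra. }
  nra.
Qed.

(** The functional equation carries the expansion at [0] over to [z], at the cost of the factor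
    [exp (fst z)]. *)
Lemma cder_Cexp z : cder Cexp z (Cexp z).
Proof.
  intros eps Heps. pose proof (exp_pos (fst z)) as Hp.
  destruct (Cexp_near_0 (eps / exp (fst z)) ltac:(now apply Rdiv_lt_0_compat)) as [d [Hd H]].
  exists d; split; trivial. intros w Hw. specialize (H _ Hw).
  replace w with (z + (w - z))%C at 1 by ring. rewrite Cexp_plus.
  replace (Cexp z * Cexp (w - z) - Cexp z - Cexp z * (w - z))%C
    with (Cexp z * (Cexp (w - z) - 1 - (w - z)))%C by ring.
  rewrite Cmod_mult, Cmod_Cexp.
  apply Rle_trans with (exp (fst z) * (eps / exp (fst z) * Cmod (w - z)%C)).
  - apply Rmult_le_compat_l; lra.
  - right. field. lra.
Qed.

Lemma rder_expi c t : rder (fun s => expi (c * s)) t (Ci * RtoC c * expi (c * t))%C.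
Proof. split; simpl; auto_derive; trivial; ring. Qed.

Lemma continuous_expi c t : continuous (fun s => expi (c * s)) t.
Proof. eapply rder_continuous, rder_expi. Qed.

(** * Cauchy's formulas on a circle *)

(* [G (s, t)] is a function of [exp (s + i t)]: Goursat's theorem on [[s', s] x [0, 2 pi]] makes its
   mean over [t] independent of [s], and [s -> -oo] identifies the mean. *)
Lemma periodic_mean (G : C -> C) (s : R) (L : C) :
  (forall w, fst w <= s -> exists l, cder G w l) ->
  (forall x, G (x, 2 * PI) = G (x, 0)) ->
  (forall eps, 0 < eps -> exists M, forall w, fst w < M -> Cmod (G w - L)%C <= eps) ->
  cint (fun t => G (s, t)) 0 (2 * PI) = (RtoC (2 * PI) * L)%C.
Proof.
  intros HG Hper HL. pose proof PI_RGT_0 as Hpi.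
  assert (Cont : forall w, fst w <= s -> continuous G w).
  { intros w Hw. destruct (HG w Hw) as [l Hl]. now apply cder_continuous with l. }
  assert (Cv : forall x, x <= s -> cont_on (fun t => G (x, t)) 0 (2 * PI)).
  { intros x Hx t _. now apply continuous_vertical, Cont. }
  assert (Ind : forall x, x <= s ->
    cint (fun t => G (s, t)) 0 (2 * PI) = cint (fun t => G (x, t)) 0 (2 * PI)).
  { intros x Hx.
    assert (HJ := goursat G x s 0 (2 * PI) Hx ltac:(lra) ltac:(intros w [W _]; apply HG; lra)).
    unfold rect_int in HJ.
    (* The two horizontal sides cancel by periodicity. *)
    rewrite (cint_ext _ (fun _ => RtoC 0) x s) in HJ by (trivial; intros t _; rewrite Hper; ring).
    rewrite cint_const, cint_minus in HJ by (try lra; apply Cv; lra).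
    assert (E : (cint (fun t => G (s, t)) 0 (2 * PI) - cint (fun t => G (x, t)) 0 (2 * PI))%C = 0).
    { transitivity (- Ci * (RtoC (s - x) * 0 + Ci * (cint (fun t => G (s, t)) 0 (2 * PI)
        - cint (fun t => G (x, t)) 0 (2 * PI))))%C; [|rewrite HJ; ring].
      rewrite Cmult_0_r, Cplus_0_l, Cmult_assoc.
      replace (- Ci * Ci)%C with (RtoC 1); [ring|].
      unfold Ci, Copp, Cmult, RtoC; simpl. f_equal; ring. }
    rewrite <- (Cplus_0_r (cint (fun t => G (x, t)) 0 (2 * PI))), <- E. ring. }
  assert (Z : (cint (fun t => G (s, t)) 0 (2 * PI) - RtoC (2 * PI) * L)%C = 0).
  { apply Cmod_eq_0, Rle_antisym; [|apply Cmod_ge_0]. apply le_epsilon. intros eps He.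
    destruct (HL (eps / (2 * PI)) ltac:(apply Rdiv_lt_0_compat; lra)) as [M HM].
    set (x := Rmin s (M - 1)).
    assert (Hx1 : x <= s) by apply Rmin_l.
    assert (Hx2 : x < M) by (pose proof (Rmin_r s (M - 1)) as HH; fold x in HH; lra).
    rewrite (Ind x Hx1).
    replace (RtoC (2 * PI)) with (RtoC (2 * PI - 0)) by (f_equal; ring). rewrite <- (cint_const L).
    rewrite <- cint_minus; try lra; [|now apply Cv|intros ? _; apply continuous_const].
    eapply Rle_trans.
    - apply cint_Cmod_le with (M := eps / (2 * PI)); try lra.
      + intros t Ht. apply continuous_Cminus; [now apply Cv | apply continuous_const].
      + intros t _. now apply HM.
    - right. field. lra. }
  rewrite <- (Cplus_0_r (RtoC (2 * PI) * L)), <- Z. ring.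
Qed.

Definition circ (a : C) (r t : R) : C := (a + RtoC r * expi t)%C.

Lemma Cmod_circ a r t : 0 <= r -> Cmod (circ a r t - a)%C = r.
Proof.
  intros Hr. unfold circ. replace (a + RtoC r * expi t - a)%C with (RtoC r * expi t)%C by ring.
  rewrite Cmod_mult, Cmod_R, Cmod_expi, Rabs_right; lra.
Qed.

Lemma rder_circ a r t : rder (circ a r) t (RtoC r * (Ci * expi t))%C.
Proof. split; unfold circ; simpl; auto_derive; trivial; ring. Qed.

Lemma continuous_circ a r t : continuous (circ a r) t.
Proof. eapply rder_continuous, rder_circ. Qed.

Lemma circ_2PI a r : circ a r (2 * PI) = circ a r 0.
Proof. unfold circ, expi. now rewrite cos_2PI, sin_2PI, cos_0, sin_0. Qed.

Lemma circ_ln a r t : 0 < r -> (a + Cexp (ln r, t))%C = circ a r t.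
Proof. intros Hr. now rewrite Cexp_expi, exp_ln. Qed.

Lemma exp_le_ln x r : 0 < r -> x <= ln r -> exp x <= r.
Proof.
  intros Hr [H| ->]; [|rewrite exp_ln; lra]. left. rewrite <- (exp_ln r) by trivial.
  now apply exp_increasing.
Qed.

Lemma exp_lt_ln x r : 0 < r -> x < ln r -> exp x < r.
Proof. intros Hr H. rewrite <- (exp_ln r) by trivial. now apply exp_increasing. Qed.

Lemma cder_circ_arg f a w l :
  cder f (a + Cexp w)%C l -> cder (fun u => f (a + Cexp u)%C) w (l * (0 + Cexp w))%C.
Proof.
  intros H. apply (cder_comp f (fun u => (a + Cexp u)%C)); trivial.
  apply cder_plus; [apply cder_const | apply cder_Cexp].
Qed.

(** In the coordinate [w] with [z = a + e^w], the circle of radius [r] is the vertical segment over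
    [ln r], and the limit required by [periodic_mean] is the continuity of [f] at [a]. *)
Lemma circle_mean (f : C -> C) (a : C) (r : R) :
  0 < r -> (forall z, Cmod (z - a)%C <= r -> exists l, cder f z l) ->
  cint (fun t => f (circ a r t)) 0 (2 * PI) = (RtoC (2 * PI) * f a)%C.
Proof.
  intros Hr Hf. pose proof PI_RGT_0.
  rewrite (cint_ext _ (fun t => f (a + Cexp (ln r, t))%C)) by (try lra; intros t _; now rewrite circ_ln).
  assert (Hd : forall w, Cmod (a + Cexp w - a)%C = exp (fst w)).
  { intros w. replace (a + Cexp w - a)%C with (Cexp w) by ring. apply Cmod_Cexp. }
  apply (periodic_mean (fun w => f (a + Cexp w)%C)).
  - intros w Hw. destruct (Hf (a + Cexp w)%C) as [l Hl].
    + rewrite Hd. now apply exp_le_ln.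
    + eexists. apply cder_circ_arg, Hl.
  - intros x. now rewrite Cexp_2PI.
  - intros eps He. destruct (Hf a) as [l Hl].
    { replace (a - a)%C with (RtoC 0) by ring. rewrite Cmod_0. lra. }
    destruct (locally_C_Cmod _ _ (proj1 (continuous_C_iff _ _) (cder_continuous _ _ _ Hl) eps He))
      as [d [Hd0 Hw]].
    exists (ln d). intros w Hlt. left. apply Hw. rewrite Hd. now apply exp_lt_ln.
Qed.

Lemma cint_expi_opp : cint (fun t => expi (- (1) * t)) 0 (2 * PI) = 0.
Proof.
  pose proof PI_RGT_0.
  rewrite (cint_ext _ (fun t => Ci * (Ci * RtoC (- (1)) * expi (- (1) * t)))%C).
  - rewrite cint_Cmult; [| lra |].
    + rewrite (cint_rder (fun t => expi (- (1) * t))); [| lra | |].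
      * replace (- (1) * (2 * PI)) with (- (INR 1 * (2 * PI))) by (simpl; ring).
        rewrite expi_opp_2PI, Rmult_0_r. unfold expi. rewrite cos_0, sin_0. fold (RtoC 1). ring.
      * intros t _. apply rder_expi.
      * intros t _. apply continuous_Cmult; [apply continuous_const | apply continuous_expi].
    + intros t _. apply continuous_Cmult; [apply continuous_const | apply continuous_expi].
  - lra.
  - intros t _. rewrite !Cmult_assoc. replace (Ci * Ci * RtoC (- (1)))%C with (RtoC 1); [ring|].
    unfold Ci, Cmult, RtoC; simpl. f_equal; ring.
Qed.

(** [periodic_mean] is applied to the difference quotient [(f (a + e^w) - f a) e^(-w)], which tends
    to [l] as the real part of [w] tends to minus infinity. The constant [f a] then drops out
    because [e^(-it)] has mean zero. *)
Lemma circle_derivative (f : C -> C) (a l : C) (r : R) :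
  0 < r -> (forall z, Cmod (z - a)%C <= r -> exists l, cder f z l) -> cder f a l ->
  cint (fun t => f (circ a r t) * expi (- (1) * t))%C 0 (2 * PI) = (RtoC (2 * PI * r) * l)%C.
Proof.
  intros Hr Hf Hl. pose proof PI_RGT_0.
  set (G := fun w => ((f (a + Cexp w) + - f a) * Cexp (- (1) * w))%C).
  assert (Hd : forall w, Cmod (a + Cexp w - a)%C = exp (fst w)).
  { intros w. replace (a + Cexp w - a)%C with (Cexp w) by ring. apply Cmod_Cexp. }
  assert (Hopp : forall w, Cmod (Cexp (- (1) * w)%C) * exp (fst w) = 1).
  { intros w. rewrite Cmod_Cexp, <- exp_plus.
    replace (fst (- (1) * w)%C + fst w) with 0 by (simpl; ring). apply exp_0. }
  assert (HGm : cint (fun t => G (ln r, t)) 0 (2 * PI) = (RtoC (2 * PI) * l)%C).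
  { apply periodic_mean.
    - intros w Hw. destruct (Hf (a + Cexp w)%C) as [m Hm].
      + rewrite Hd. now apply exp_le_ln.
      + eexists. apply cder_mult.
        * apply cder_plus; [apply cder_circ_arg, Hm | apply cder_const].
        * apply (cder_comp Cexp (fun w => (- (1) * w)%C)); [|apply cder_Cexp].
          apply cder_mult; [apply cder_const | apply cder_id].
    - intros x. unfold G. rewrite Cexp_2PI. f_equal.
      unfold Cexp, Cmult, Copp; simpl.
      replace (- (1) * (2 * PI) + - 0 * x) with (- (2 * PI)) by ring.
      replace (- (1) * 0 + - 0 * x) with (- 0) by ring.
      rewrite !cos_neg, !sin_neg, cos_2PI, sin_2PI, cos_0, sin_0.
      now replace (- (1) * x - - 0 * (2 * PI)) with (- (1) * x - - 0 * 0) by ring.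
    - intros eps He. destruct (Hl eps He) as [d [Hd0 Hw]].
      exists (ln d). intros w Hlt. specialize (Hw (a + Cexp w)%C).
      rewrite Hd in Hw. specialize (Hw (exp_lt_ln _ _ Hd0 Hlt)).
      assert (Hinv : (Cexp w * Cexp (- (1) * w))%C = 1).
      { rewrite <- Cexp_plus. replace (w + - (1) * w)%C with (RtoC 0) by ring.
        unfold Cexp, RtoC; simpl. rewrite exp_0, cos_0, sin_0. f_equal; ring. }
      replace (G w - l)%C with ((f (a + Cexp w) - f a - l * (a + Cexp w - a)) * Cexp (- (1) * w))%C.
      + rewrite Cmod_mult. specialize (Hopp w).
        pose proof (Cmod_ge_0 (Cexp (- (1) * w)%C)).
        apply Rle_trans with (eps * exp (fst w) * Cmod (Cexp (- (1) * w)%C)).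
        * now apply Rmult_le_compat_r.
        * rewrite Rmult_assoc, (Rmult_comm (exp _)), Hopp. lra.
      + unfold G. transitivity ((f (a + Cexp w) - f a) * Cexp (- (1) * w) - l * (Cexp w * Cexp (- (1) * w)))%C;
          [ring | rewrite Hinv; ring]. }
  assert (Cf : cont_on (fun t => f (circ a r t) * expi (- (1) * t))%C 0 (2 * PI)).
  { intros t _. apply continuous_Cmult; [|apply continuous_expi].
    apply (continuous_comp (circ a r) f); [apply continuous_circ|].
    destruct (Hf (circ a r t)) as [m Hm]; [rewrite Cmod_circ; lra|]. now apply cder_continuous with m. }
  assert (Ce : cont_on (fun t => expi (- (1) * t)) 0 (2 * PI)) by (intros t _; apply continuous_expi).
  rewrite (cint_ext _ (fun t => RtoC (/ r) * (f (circ a r t) * expi (- (1) * t))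
                         + (- (RtoC (/ r) * f a)) * expi (- (1) * t))%C) in HGm.
  - rewrite cint_plus, !cint_Cmult, cint_expi_opp in HGm; trivial; try lra.
    + rewrite RtoC_mult, (Cmult_comm (RtoC (2 * PI))), <- Cmult_assoc, <- HGm.
      rewrite RtoC_inv by lra. field. intros E. apply RtoC_inj in E. lra.
    + intros t Ht. apply continuous_Cmult; [apply continuous_const | now apply Cf].
    + intros t Ht. apply continuous_Cmult; [apply continuous_const | now apply Ce].
  - lra.
  - intros t _. unfold G. rewrite circ_ln by trivial.
    replace (Cexp (- (1) * (ln r, t)))%C with (RtoC (/ r) * expi (- (1) * t))%C; [ring|].
    replace (- (1) * (ln r, t))%C with ((- ln r, - (1) * t) : C)
      by (unfold Copp, RtoC, Cmult; simpl; f_equal; ring).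
    now rewrite Cexp_expi, exp_Ropp, exp_ln.
Qed.

(** * Integrals depending on a parameter *)

(** Compactness of [[a, b]] by a supremum argument: [E] collects the [s] for which one neighbourhood
    of [x] serves all of [[a, s]]. It supplies the uniformity in [t] behind every passage to the
    limit under the integral. *)
Lemma tube_lemma {U : UniformSpace} (P : U -> R -> Prop) (x : U) (a b : R) :
  a <= b ->
  (forall t, a <= t <= b -> locally ((x, t) : U * R) (fun p => P (fst p) (snd p))) ->
  locally x (fun y => forall t, a <= t <= b -> P y t).
Proof.
  intros Hab HP.
  set (E := fun s => a <= s <= b /\ locally x (fun y => forall t, a <= t <= s -> P y t)).
  assert (Ea : E a).
  { split; [lra|]. destruct (HP a ltac:(lra)) as [e He]. exists e. intros y Hy t Ht.
    replace t with a by lra. apply (He (y, a)). split; [exact Hy | apply ball_center]. }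
  destruct (completeness E) as [m [Hm1 Hm2]].
  { exists b. intros s [Hs _]. lra. }
  { now exists a. }
  assert (Ham : a <= m) by now apply Hm1.
  assert (Hmb : m <= b) by (apply Hm2; intros s [Hs _]; lra).
  destruct (HP m ltac:(lra)) as [e He]. pose proof (cond_pos e) as Hepos.
  assert (Hs : exists s, E s /\ m - e < s).
  { apply NNPP. intros Hno. assert (m <= m - e); [|lra].
    apply Hm2. intros s Es. destruct (Rle_dec s (m - e)); trivial.
    exfalso. apply Hno. exists s. split; trivial. lra. }
  destruct Hs as [s [[Hs1 Hs2] Hs3]].
  assert (Em : E (Rmin b (m + e / 2))).
  { split; [split; [apply Rmin_glb; lra | apply Rmin_l]|].
    assert (Le : locally x (fun y => ball x e y)) by (exists e; trivial).
    apply filter_imp with (2 := filter_and _ _ Hs2 Le). intros y [Hy1 Hy2] t Ht.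
    destruct (Rle_dec t s) as [Hts|Hts]; [apply Hy1; lra|].
    apply (He (y, t)). split; [exact Hy2|]. simpl.
    pose proof (Rmin_r b (m + e / 2)).
    change (Rabs (t - m) < e). apply Rabs_lt_between'. lra. }
  pose proof (Hm1 _ Em) as Hle. pose proof (Rmin_l b (m + e / 2)) as Hl.
  (* No element of [E] exceeds [m], so the minimum cannot be [m + e / 2]. *)
  assert (Hb : Rmin b (m + e / 2) = b).
  { unfold Rmin in *. destruct (Rle_dec b (m + e / 2)); lra. }
  rewrite Hb in Em. apply Em.
Qed.

Lemma continuous_section {U : UniformSpace} (H : U -> R -> C) (x : U) (t : R) :
  continuous (fun p : U * R => H (fst p) (snd p)) (x, t) -> continuous (H x) t.
Proof.
  intros Hc. apply (continuous_comp_2 (fun _ => x) (fun s : R => s) H); trivial.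
  - apply continuous_const.
  - apply continuous_id.
Qed.

Lemma uniform_near_compact {U : UniformSpace} (H : U -> R -> C) (x : U) (a b eps : R) :
  a <= b -> 0 < eps ->
  (forall t, a <= t <= b -> continuous (fun p : U * R => H (fst p) (snd p)) (x, t)) ->
  locally x (fun y => forall t, a <= t <= b -> Cmod (H y t - H x t)%C < eps).
Proof.
  intros Hab Heps Hc.
  apply (tube_lemma (fun y t => Cmod (H y t - H x t)%C < eps)); trivial.
  intros t Ht.
  destruct (proj1 (continuous_C_iff _ _) (Hc t Ht) (eps / 2) ltac:(lra)) as [e He].
  exists e. intros [y s] [Hy Hs]. simpl in *.
  pose proof (He (y, s) (conj Hy Hs)) as H1.
  pose proof (He (x, s) (conj (ball_center x e) Hs)) as H2. simpl in H1, H2.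
  replace (H y s - H x s)%C with ((H y s - H x t) + - (H x s - H x t))%C by ring.
  eapply Rle_lt_trans; [apply Cmod_triangle|]. rewrite Cmod_opp. lra.
Qed.

Lemma continuous_cint_param {U : UniformSpace} (H : U -> R -> C) (x : U) (a b : R) :
  a <= b ->
  locally x (fun y => forall t, a <= t <= b ->
    continuous (fun p : U * R => H (fst p) (snd p)) (y, t)) ->
  continuous (fun y => cint (H y) a b) x.
Proof.
  intros Hab Hc. apply continuous_C_iff. intros eps He.
  set (e := eps / (b - a + 1)).
  assert (He0 : 0 < e) by (apply Rdiv_lt_0_compat; lra).
  assert (Ee : e * (b - a + 1) = eps) by (unfold e; field; lra).
  pose proof (locally_singleton _ _ Hc) as Hx.
  apply filter_imp with (2 := filter_and _ _ Hc (uniform_near_compact H x a b e Hab He0 Hx)).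
  intros y [Hy1 Hy2].
  assert (C1 : cont_on (H y) a b) by (intros t Ht; now apply continuous_section, Hy1).
  assert (C2 : cont_on (H x) a b) by (intros t Ht; now apply continuous_section, Hx).
  rewrite <- cint_minus by trivial.
  apply Rle_lt_trans with ((b - a) * e); [|nra].
  apply cint_Cmod_le; trivial.
  - intros t Ht. apply continuous_Cminus; auto.
  - intros t Ht. left. now apply Hy2.
Qed.

Lemma rder_segment (z w : C) (s : R) :
  rder (fun s => z + RtoC s * (w - z))%C s (w - z)%C.
Proof. split; simpl; auto_derive; trivial; ring. Qed.

(** The mean value theorem fails for complex values, so the real one is applied to the projection
    [phi] of [f] along the segment onto the direction [u = f w - f z]. Its total increase is
    [Cmod u ^ 2], and one factor [Cmod u] cancels. *)
Lemma cder_mean_value (f df : C -> C) (z w : C) (M : R) :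
  (forall s, 0 <= s <= 1 -> cder f (z + RtoC s * (w - z))%C (df (z + RtoC s * (w - z))%C)
     /\ Cmod (df (z + RtoC s * (w - z))%C) <= M) ->
  Cmod (f w - f z)%C <= M * Cmod (w - z)%C.
Proof.
  intros Hf.
  set (u := (f w - f z)%C).
  set (g := fun s => f (z + RtoC s * (w - z))%C).
  set (dg := fun s => (df (z + RtoC s * (w - z)) * (w - z))%C).
  assert (Hg : forall s, 0 <= s <= 1 -> rder g s (dg s)).
  { intros s Hs. apply (cder_rder_comp f (fun s => z + RtoC s * (w - z))%C).
    - apply rder_segment.
    - now apply Hf. }
  set (phi := fun s => fst u * fst (g s) + snd u * snd (g s)).
  set (dphi := fun s => fst u * fst (dg s) + snd u * snd (dg s)).
  assert (Hphi : forall s, 0 <= s <= 1 -> is_derive phi s (dphi s)).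
  { intros s Hs. destruct (Hg s Hs) as [H1 H2].
    apply (is_derive_plus (V := R_NormedModule) (fun s => fst u * fst (g s)) (fun s => snd u * snd (g s)));
      now apply is_derive_scal. }
  destruct (MVT_gen phi 0 1 dphi) as [c [Hc Heq]].
  { intros s Hs. rewrite Rmin_left, Rmax_right in Hs by lra. apply Hphi; lra. }
  { intros s Hs. rewrite Rmin_left, Rmax_right in Hs by lra.
    apply continuity_pt_filterlim, (ex_derive_continuous (K := R_AbsRing) (V := R_NormedModule)).
    exists (dphi s). now apply Hphi. }
  rewrite Rmin_left, Rmax_right in Hc by lra.
  assert (Hdot : forall x y : C, fst x * fst y + snd x * snd y <= Cmod x * Cmod y).
  { intros x y. rewrite <- (Cmod_conj x), <- Cmod_mult.
    eapply Rle_trans; [|apply Cmod_Re_le]. eapply Rle_trans; [|apply Rle_abs].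
    right. simpl. ring. }
  assert (E : phi 1 - phi 0 = Cmod u * Cmod u).
  { transitivity (fst u ^ 2 + snd u ^ 2).
    - unfold phi, g. replace (z + RtoC 1 * (w - z))%C with w by ring.
      replace (z + RtoC 0 * (w - z))%C with z by ring. unfold u. simpl. ring.
    - symmetry. replace (Cmod u * Cmod u) with (Cmod u ^ 2) by ring. rewrite Cmod2_alt. reflexivity. }
  assert (B : Cmod u * Cmod u <= Cmod u * (M * Cmod (w - z)%C)).
  { rewrite <- E, Heq, Rminus_0_r, Rmult_1_r. eapply Rle_trans; [apply Hdot|].
    apply Rmult_le_compat_l; [apply Cmod_ge_0|]. unfold dg. rewrite Cmod_mult.
    apply Rmult_le_compat_r; [apply Cmod_ge_0|]. now apply Hf. }
  destruct (Cmod_ge_0 u) as [Hu|Hu].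
  - now apply Rmult_le_reg_l in B.
  - rewrite <- Hu. apply Rmult_le_pos; [|apply Cmod_ge_0].
    eapply Rle_trans; [apply Cmod_ge_0|]. apply (Hf 0). lra.
Qed.

(** The integrand of the remainder is the increment of [v -> H v t - D z t * v], whose derivative
    [D v t - D z t] is small uniformly in [t]; the mean value inequality makes that increment
    [o(w - z)] uniformly in [t]. *)
Lemma cder_cint_param (H D : C -> R -> C) (z : C) (a b : R) :
  a <= b ->
  locally z (fun w : C => forall t, a <= t <= b ->
    continuous (H w) t /\ cder (fun w => H w t) w (D w t) /\
    continuous (fun p : C * R => D (fst p) (snd p)) (w, t)) ->
  cder (fun w => cint (H w) a b) z (cint (D z) a b).
Proof.
  intros Hab Hloc eps He.
  set (e := eps / (b - a + 1)).
  assert (He0 : 0 < e) by (apply Rdiv_lt_0_compat; lra).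
  assert (Ee : e * (b - a + 1) = eps) by (unfold e; field; lra).
  pose proof (locally_singleton _ _ Hloc) as Hz.
  assert (HDz : forall t, a <= t <= b -> continuous (fun p : C * R => D (fst p) (snd p)) (z, t)).
  { intros t Ht. now apply Hz. }
  destruct (locally_C_Cmod _ _ (filter_and _ _ Hloc (uniform_near_compact D z a b e Hab He0 HDz)))
    as [d [Hd Hw]].
  exists d; split; trivial. intros w Hlt.
  assert (CHw : cont_on (H w) a b) by (intros t Ht; exact (proj1 (proj1 (Hw w Hlt) t Ht))).
  assert (CHz : cont_on (H z) a b) by (intros t Ht; exact (proj1 (Hz t Ht))).
  assert (CDz : cont_on (D z) a b) by (intros t Ht; now apply continuous_section, HDz).
  assert (CDz' : cont_on (fun t => (w - z) * D z t)%C a b).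
  { intros t Ht. apply continuous_Cmult; [apply continuous_const | now apply CDz]. }
  rewrite (Cmult_comm (cint (D z) a b)), <- cint_Cmult, <- !cint_minus; trivial.
  2:{ intros t Ht. apply continuous_Cminus; [exact (CHw t Ht) | exact (CHz t Ht)]. }
  pose proof (Cmod_ge_0 (w - z)%C) as Hx.
  apply Rle_trans with ((b - a) * (e * Cmod (w - z)%C)); [|rewrite <- Ee; nra].
  apply cint_Cmod_le; trivial.
  { intros t Ht. apply continuous_Cminus; [|exact (CDz' t Ht)].
    apply continuous_Cminus; [exact (CHw t Ht) | exact (CHz t Ht)]. }
  intros t Ht.
  set (h := fun v : C => (H v t + - D z t * v)%C).
  replace (H w t - H z t - (w - z) * D z t)%C with (h w - h z)%C by (unfold h; ring).
  apply (cder_mean_value h (fun v => (D v t + (0 * v + - D z t * 1))%C)).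
  intros s Hs. set (v := (z + RtoC s * (w - z))%C).
  assert (Hv : Cmod (v - z)%C < d).
  { replace (v - z)%C with (RtoC s * (w - z))%C by (unfold v; ring).
    rewrite Cmod_mult, Cmod_R, Rabs_right by lra. eapply Rle_lt_trans; [|exact Hlt]. nra. }
  destruct (Hw v Hv) as [V1 V2]. split.
  - apply cder_plus; [now apply V1|].
    apply (cder_mult (fun _ => - D z t)%C (fun v => v)); [apply cder_const | apply cder_id].
  - replace (D v t + (0 * v + - D z t * 1))%C with (D v t - D z t)%C by ring. left. now apply V2.
Qed.

(** * Functions of two variables on the bidisc *)

(** The working form of [analytic_bidisc]: the derivatives are the named functions [d1 F] and
    [d2 F], so that the property can be asked of them in turn. *)
Definition holomorphic_bidisc (F : C * C -> C) : Prop :=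
  forall z, bidisc z ->
    continuous F z /\
    cder (fun w => F (w, snd z)) (fst z) (d1 F z) /\
    cder (fun w => F (fst z, w)) (snd z) (d2 F z).

Lemma analytic_holomorphic F : analytic_bidisc F -> holomorphic_bidisc F.
Proof.
  intros H z Hz. destruct (H z Hz) as [H1 [H2 H3]].
  repeat split; trivial; now apply ex_derive_cder.
Qed.

(** Conjugation by this exchange turns [d1] into [d2], so several facts are proved in the first
    variable only. *)
Definition swap_args (F : C * C -> C) : C * C -> C := fun z => F (snd z, fst z).

Lemma bidisc_swap z : bidisc z -> bidisc (snd z, fst z).
Proof. now intros [H1 H2]. Qed.

Lemma continuous_swap (F : C * C -> C) z :
  continuous F (snd z, fst z) -> continuous (swap_args F) z.
Proof.
  intros H. apply (continuous_comp_2 (fun z : C * C => snd z) (fun z : C * C => fst z) (fun a b => F (a, b))).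
  - destruct z; apply continuous_snd.
  - destruct z; apply continuous_fst.
  - apply (continuous_ext F); trivial. now intros [x y].
Qed.

Lemma holomorphic_swap F : holomorphic_bidisc F -> holomorphic_bidisc (swap_args F).
Proof.
  intros H z Hz. destruct (H _ (bidisc_swap z Hz)) as [H1 [H2 H3]].
  split; [now apply continuous_swap | now split].
Qed.

Lemma locally_Cmod_lt (z : C) (m : R) : Cmod z < m -> locally z (fun w : C => Cmod w < m).
Proof.
  intros H. apply filter_imp with (2 := Cmod_lt_locally z (m - Cmod z) ltac:(lra)).
  intros w Hw. replace w with (z + (w - z))%C by ring. eapply Rle_lt_trans; [apply Cmod_triangle|]. lra.
Qed.

Lemma locally_bidisc z : bidisc z -> locally z bidisc.
Proof.
  destruct z as [z1 z2]. intros [H1 H2]; simpl in *.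
  destruct (locally_Cmod_lt z1 1 H1) as [e1 E1]. destruct (locally_Cmod_lt z2 1 H2) as [e2 E2].
  exists (mkposreal (Rmin e1 e2) (Rmin_pos _ _ (cond_pos e1) (cond_pos e2))).
  intros [y1 y2] [Y1 Y2]. split; simpl in *.
  - apply E1. eapply ball_le; [|exact Y1]. apply Rmin_l.
  - apply E2. eapply ball_le; [|exact Y2]. apply Rmin_r.
Qed.


Lemma locally_bidisc_2 z : bidisc z -> locally (snd z) (fun w : C => bidisc (fst z, w)).
Proof.
  intros H. destruct (locally_bidisc z H) as [e He]. exists e. intros w Hw.
  apply He. split; [apply ball_center | exact Hw].
Qed.

Lemma disc_center (z w : C) r m : Cmod z + r < m -> Cmod (w - z)%C <= r -> Cmod w < m.
Proof.
  intros H Hw. replace w with (z + (w - z))%C by ring. eapply Rle_lt_trans; [apply Cmod_triangle|]. lra.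
Qed.

Lemma d1_circle F z r :
  holomorphic_bidisc F -> 0 < r -> Cmod (fst z) + r < 1 -> Cmod (snd z) < 1 ->
  d1 F z = (RtoC (/ (2 * PI * r)) *
    cint (fun t => F (circ (fst z) r t, snd z) * expi (- (1) * t)) 0 (2 * PI))%C.
Proof.
  intros HF Hr H1 H2. pose proof PI_RGT_0.
  rewrite (circle_derivative (fun w => F (w, snd z)) (fst z) (d1 F z)); trivial.
  - rewrite Cmult_assoc, <- RtoC_mult, Rinv_l, Cmult_1_l; trivial.
    assert (0 < 2 * PI * r) by (apply Rmult_lt_0_compat; lra). lra.
  - intros w Hw. eexists. apply (HF (w, snd z)). split; simpl; trivial.
    eapply disc_center; eassumption.
  - apply (HF z). split; trivial. lra.
Qed.

Lemma circle_in_disc (z : C) r t : 0 < r -> Cmod z + r < 1 -> Cmod (circ z r t) < 1.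
Proof. intros Hr Hz. apply (disc_center z) with r; trivial. rewrite Cmod_circ; lra. Qed.

Lemma continuous_circle_integrand F (z : C * C) r t :
  (forall w, bidisc w -> continuous F w) ->
  0 < r -> Cmod (fst z) + r < 1 -> Cmod (snd z) < 1 ->
  continuous (fun p : C * C * R =>
    (F (circ (fst (fst p)) r (snd p), snd (fst p)) * expi (- (1) * snd p))%C) (z, t).
Proof.
  intros HF Hr H1 H2.
  assert (Cs : continuous (fun p : C * C * R => snd p) (z, t)) by apply continuous_snd.
  assert (Cf : continuous (fun p : C * C * R => fst p) (z, t)) by apply continuous_fst.
  assert (Cff : continuous (fun p : C * C * R => fst (fst p)) (z, t)).
  { apply (continuous_comp (fun p : C * C * R => fst p) (fun q : C * C => fst q)); trivial.
    destruct z; apply continuous_fst. }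
  assert (Cfs : continuous (fun p : C * C * R => snd (fst p)) (z, t)).
  { apply (continuous_comp (fun p : C * C * R => fst p) (fun q : C * C => snd q)); trivial.
    destruct z; apply continuous_snd. }
  apply continuous_Cmult.
  - apply (continuous_comp_2 (fun p : C * C * R => circ (fst (fst p)) r (snd p))
             (fun p : C * C * R => snd (fst p)) (fun a b => F (a, b))).
    + apply continuous_Cplus; trivial. apply continuous_Cmult; [apply continuous_const|].
      apply (continuous_comp (fun p : C * C * R => snd p) expi); trivial.
      apply continuous_C_pair; [apply continuous_cos | apply continuous_sin].
    + trivial.
    + apply (continuous_ext F); [now intros [x y]|]. apply HF. split; trivial. now apply circle_in_disc.
  - apply (continuous_comp (fun p : C * C * R => snd p) (fun s => expi (- (1) * s))); trivial.
    apply continuous_expi.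
Qed.

Lemma radius_exists (m : R) : m < 1 -> exists r, 0 < r /\ m + r < 1.
Proof. intros H. exists ((1 - m) / 2). lra. Qed.

Lemma continuous_d1 F : holomorphic_bidisc F -> forall z, bidisc z -> continuous (d1 F) z.
Proof.
  intros HF z [Hz1 Hz2]. pose proof PI_RGT_0.
  destruct (radius_exists _ Hz1) as [r [Hr Hzr]].
  (* One radius, chosen at [z], remains admissible at all nearby points, so the integral formula
     holds on a whole neighbourhood. *)
  assert (L : locally z (fun y : C * C => Cmod (fst y) + r < 1 /\ Cmod (snd y) < 1)).
  { destruct z as [z1 z2]. simpl in *.
    destruct (locally_Cmod_lt z1 (1 - r) ltac:(lra)) as [e1 E1].
    destruct (locally_Cmod_lt z2 1 Hz2) as [e2 E2].
    exists (mkposreal (Rmin e1 e2) (Rmin_pos _ _ (cond_pos e1) (cond_pos e2))).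
    intros [y1 y2] [Y1 Y2]. simpl in *. split.
    - specialize (E1 y1 (ball_le _ _ _ (Rmin_l e1 e2) _ Y1)). lra.
    - exact (E2 y2 (ball_le _ _ _ (Rmin_r e1 e2) _ Y2)). }
  apply (continuous_ext_loc _ (fun y : C * C => RtoC (/ (2 * PI * r)) *
    cint (fun t => F (circ (fst y) r t, snd y) * expi (- (1) * t)) 0 (2 * PI))%C).
  { apply filter_imp with (2 := L). intros y [Y1 Y2]. symmetry. now apply d1_circle. }
  apply continuous_Cmult; [apply continuous_const|].
  apply (continuous_cint_param (fun (y : C * C) t => F (circ (fst y) r t, snd y) * expi (- (1) * t))%C); [lra|].
  apply filter_imp with (2 := L). intros y [Y1 Y2] t _.
  apply continuous_circle_integrand; trivial. intros w Hw. now apply HF.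
Qed.

Lemma continuous_d2 F : holomorphic_bidisc F -> forall z, bidisc z -> continuous (d2 F) z.
Proof.
  intros HF z Hz. apply (continuous_swap (d1 (swap_args F))).
  apply continuous_d1; [now apply holomorphic_swap | now apply bidisc_swap].
Qed.

Lemma cder_scaled_ext f g z l c :
  locally z (fun w : C => f w = (c * g w)%C) -> cder g z l -> cder f z (c * l)%C.
Proof.
  intros Hloc Hg. apply (cder_ext_loc (fun w => c * g w)%C).
  - apply filter_imp with (2 := Hloc). now intros w ->.
  - replace (c * l)%C with (0 * g z + c * l)%C by ring. apply cder_mult; trivial. apply cder_const.
Qed.

(** The circle moves with its centre at fixed radius, so differentiating the integral formula puts
    [d1] on the [F] under the integral; this is legitimate because [d1 F] is already known to be
    continuous. *)
Lemma d1_d1_cder F z : holomorphic_bidisc F -> bidisc z ->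
  exists l, cder (fun w => d1 F (w, snd z)) (fst z) l.
Proof.
  intros HF [Hz1 Hz2]. pose proof PI_RGT_0.
  destruct (radius_exists _ Hz1) as [r [Hr Hzr]].
  assert (L : locally (fst z) (fun w : C => Cmod w + r < 1)).
  { apply filter_imp with (2 := locally_Cmod_lt (fst z) (1 - r) ltac:(lra)). intros w; lra. }
  eexists. eapply (cder_scaled_ext _ (fun w => cint (fun t =>
    F (circ w r t, snd z) * expi (- (1) * t))%C 0 (2 * PI)) (fst z) _ (RtoC (/ (2 * PI * r)))).
  { apply filter_imp with (2 := L). intros w Hw. apply (d1_circle F (w, snd z)); trivial. }
  apply (cder_cint_param (fun w t => F (circ w r t, snd z) * expi (- (1) * t))%C
           (fun w t => d1 F (circ w r t, snd z) * expi (- (1) * t))%C); [lra|].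
  apply filter_imp with (2 := L). intros w Hw t _. split; [|split].
  - apply (continuous_section (fun (y : C * C) t => F (circ (fst y) r t, snd y) * expi (- (1) * t))%C (w, snd z)).
    apply continuous_circle_integrand; trivial. intros; now apply HF.
  - replace (d1 F (circ w r t, snd z) * expi (- (1) * t))%C
      with ((d1 F (circ w r t, snd z) * (1 + 0)) * expi (- (1) * t) + F (circ w r t, snd z) * 0)%C by ring.
    apply (cder_mult (fun w => F (circ w r t, snd z)) (fun _ => expi (- (1) * t))); [|apply cder_const].
    apply (cder_comp (fun v => F (v, snd z)) (fun w => circ w r t)).
    + apply cder_plus; [apply cder_id | apply cder_const].
    + apply (HF (circ w r t, snd z)). split; trivial. now apply circle_in_disc.
  - apply (continuous_comp (fun p : C * R => ((fst p, snd z), snd p))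
      (fun p : C * C * R => d1 F (circ (fst (fst p)) r (snd p), snd (fst p)) * expi (- (1) * snd p))%C).
    + apply (continuous_comp_2 (fun p : C * R => (fst p, snd z)) (fun p : C * R => snd p) (fun a b => (a, b))).
      * apply (continuous_comp_2 (fun p : C * R => fst p) (fun _ => snd z) (fun a b => (a, b))).
        -- apply continuous_fst.
        -- apply continuous_const.
        -- apply (continuous_ext (fun x => x)); [now intros [? ?] | apply continuous_id].
      * apply continuous_snd.
      * apply (continuous_ext (fun x => x)); [now intros [? ?] | apply continuous_id].
    + apply (continuous_circle_integrand (d1 F) (w, snd z)); trivial. now apply continuous_d1.
Qed.

(** The derivative is kept explicit because it is precisely the circle integral that represents
    [d1 (d2 F)]. *)
Lemma d2_d1_cder F z r : holomorphic_bidisc F -> 0 < r -> Cmod (fst z) + r < 1 -> Cmod (snd z) < 1 ->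
  cder (fun w => d1 F (fst z, w)) (snd z) (RtoC (/ (2 * PI * r)) *
    cint (fun t => d2 F (circ (fst z) r t, snd z) * expi (- (1) * t)) 0 (2 * PI))%C.
Proof.
  intros HF Hr Hz1 Hz2. pose proof PI_RGT_0.
  assert (L : locally (snd z) (fun w : C => Cmod w < 1)) by now apply locally_Cmod_lt.
  apply (cder_scaled_ext _ (fun w => cint (fun t =>
    F (circ (fst z) r t, w) * expi (- (1) * t))%C 0 (2 * PI))).
  { apply filter_imp with (2 := L). intros w Hw. apply (d1_circle F (fst z, w)); trivial. }
  apply (cder_cint_param (fun w t => F (circ (fst z) r t, w) * expi (- (1) * t))%C
           (fun w t => d2 F (circ (fst z) r t, w) * expi (- (1) * t))%C); [lra|].
  apply filter_imp with (2 := L). intros w Hw t _. split; [|split].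
  - apply (continuous_section (fun (y : C * C) t => F (circ (fst y) r t, snd y) * expi (- (1) * t))%C (fst z, w)).
    apply continuous_circle_integrand; trivial. intros; now apply HF.
  - replace (d2 F (circ (fst z) r t, w) * expi (- (1) * t))%C
      with (d2 F (circ (fst z) r t, w) * expi (- (1) * t) + F (circ (fst z) r t, w) * 0)%C by ring.
    apply (cder_mult (fun w => F (circ (fst z) r t, w)) (fun _ => expi (- (1) * t))); [|apply cder_const].
    apply (HF (circ (fst z) r t, w)). split; trivial. now apply circle_in_disc.
  - apply (continuous_comp (fun p : C * R => ((fst z, fst p), snd p))
      (fun p : C * C * R => d2 F (circ (fst (fst p)) r (snd p), snd (fst p)) * expi (- (1) * snd p))%C).
    + apply (continuous_comp_2 (fun p : C * R => (fst z, fst p)) (fun p : C * R => snd p) (fun a b => (a, b))).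
      * apply (continuous_comp_2 (fun _ => fst z) (fun p : C * R => fst p) (fun a b => (a, b))).
        -- apply continuous_const.
        -- apply continuous_fst.
        -- apply (continuous_ext (fun x => x)); [now intros [? ?] | apply continuous_id].
      * apply continuous_snd.
      * apply (continuous_ext (fun x => x)); [now intros [? ?] | apply continuous_id].
    + apply (continuous_circle_integrand (d2 F) (fst z, w)); trivial. now apply continuous_d2.
Qed.

Lemma holomorphic_d1 F : holomorphic_bidisc F -> holomorphic_bidisc (d1 F).
Proof.
  intros HF z Hz. split; [now apply continuous_d1|]. split.
  - destruct (d1_d1_cder F z HF Hz) as [l Hl]. unfold d1 at 2. now rewrite (cder_C_derive _ _ _ Hl).
  - destruct Hz as [Hz1 Hz2]. destruct (radius_exists _ Hz1) as [r [Hr Hzr]].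
    pose proof (d2_d1_cder F z r HF Hr Hzr Hz2) as Hl. unfold d2.
    now rewrite (cder_C_derive _ _ _ Hl).
Qed.

Lemma holomorphic_d2 F : holomorphic_bidisc F -> holomorphic_bidisc (d2 F).
Proof.
  intros HF.
  (* [swap_args (d1 (swap_args F))] is convertible to [d2 F], and likewise for its partial
     derivatives. *)
  pose proof (holomorphic_swap _ (holomorphic_d1 _ (holomorphic_swap _ HF))) as H.
  intros z Hz. destruct (H z Hz) as [H1 [H2 H3]]. split; [|split; assumption].
  exact H1.
Qed.

Lemma d2_d1_comm F z : holomorphic_bidisc F -> bidisc z -> d2 (d1 F) z = d1 (d2 F) z.
Proof.
  intros HF [Hz1 Hz2]. destruct (radius_exists _ Hz1) as [r [Hr Hzr]].
  unfold d2 at 1. rewrite (cder_C_derive _ _ _ (d2_d1_cder F z r HF Hr Hzr Hz2)).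
  symmetry. apply d1_circle; trivial. now apply holomorphic_d2.
Qed.

(** * Mixed partial derivatives of all orders *)

Lemma holomorphic_iter_d1 n : forall F, holomorphic_bidisc F -> holomorphic_bidisc (Nat.iter n d1 F).
Proof. induction n as [|n IH]; intros F HF; trivial. apply holomorphic_d1, IH, HF. Qed.

Lemma holomorphic_pderiv F p q : holomorphic_bidisc F -> holomorphic_bidisc (pderiv F p q).
Proof.
  intros HF. unfold pderiv. induction q as [|q IH]; simpl.
  - now apply holomorphic_iter_d1.
  - now apply holomorphic_d2.
Qed.

(** A derivative sees only a neighbourhood and the bidisc is open. This matters because the partial
    derivatives are only known to commute inside the bidisc, not as functions on all of [C * C]. *)
Lemma d2_ext_bidisc F G z :
  (forall w, bidisc w -> F w = G w) -> holomorphic_bidisc F -> bidisc z -> d2 F z = d2 G z.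
Proof.
  intros Heq HF Hz. destruct (HF z Hz) as [_ [_ H]]. symmetry. unfold d2 at 1.
  apply cder_C_derive. apply cder_ext_loc with (2 := H).
  apply filter_imp with (2 := locally_bidisc_2 z Hz). intros w Hw. now apply Heq.
Qed.

(** In [pderiv] the [d1] are innermost, so a further [d1] has to be moved past the [q] outer copies
    of [d2]. *)
Lemma d1_pderiv F p q z :
  holomorphic_bidisc F -> bidisc z -> d1 (pderiv F p q) z = pderiv F (S p) q z.
Proof.
  intros HF. revert z. induction q as [|q IH]; intros z Hz; trivial.
  change (d1 (d2 (pderiv F p q)) z = d2 (pderiv F (S p) q) z).
  rewrite <- d2_d1_comm; trivial; [|now apply holomorphic_pderiv].
  apply d2_ext_bidisc; trivial. now apply holomorphic_d1, holomorphic_pderiv.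
Qed.

(** * Cauchy's coefficient formula and estimates *)

(** Induction by integration by parts on the circle: the boundary term vanishes by periodicity, and
    the coefficient of index [n + 1] of [F] becomes [r / (n + 1)] times the coefficient of index [n]
    of [d1 F]. The base case is the mean value property. *)
Lemma cauchy_coefficient n : forall F z r,
  holomorphic_bidisc F -> 0 < r -> Cmod (fst z) + r < 1 -> Cmod (snd z) < 1 ->
  cint (fun t => F (circ (fst z) r t, snd z) * expi (- INR n * t))%C 0 (2 * PI)
  = (RtoC (2 * PI * r ^ n / INR (fact n)) * Nat.iter n d1 F z)%C.
Proof.
  induction n as [|n IH]; intros F z r HF Hr H1 H2; pose proof PI_RGT_0 as Hpi.
  - rewrite (cint_ext _ (fun t => F (circ (fst z) r t, snd z))).
    + rewrite (circle_mean (fun w => F (w, snd z)) (fst z) r); trivial.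
      * simpl. replace (2 * PI * 1 / 1) with (2 * PI) by field. now destruct z.
      * intros w Hw. eexists. apply (HF (w, snd z)). split; trivial. eapply disc_center; eassumption.
    + lra.
    + intros t _. simpl. replace (- 0 * t) with 0 by ring. unfold expi. rewrite cos_0, sin_0.
      fold (RtoC 1). ring.
  - assert (Bi : forall t, bidisc (circ (fst z) r t, snd z)).
    { intros t. split; trivial. now apply circle_in_disc. }
    assert (Cg : forall G m, holomorphic_bidisc G ->
       cont_on (fun t => G (circ (fst z) r t, snd z) * expi (- m * t))%C 0 (2 * PI)).
    { intros G m HG t _. apply continuous_Cmult; [|apply continuous_expi].
      apply (continuous_comp (circ (fst z) r) (fun w => G (w, snd z))); [apply continuous_circ|].
      eapply cder_continuous. apply (HG _ (Bi t)). }
    set (A := cint (fun t => d1 F (circ (fst z) r t, snd z) * expi (- INR n * t))%C 0 (2 * PI)).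
    set (B := cint (fun t => F (circ (fst z) r t, snd z) * expi (- INR (S n) * t))%C 0 (2 * PI)).
    (* The combined integrand is the derivative of [F e^{-i(n+1)t}] along the circle. *)
    assert (Parts : (Ci * RtoC r * A + Ci * RtoC (- INR (S n)) * B)%C = 0).
    { unfold A, B. pose proof (holomorphic_d1 F HF) as HF1.
      assert (Hpi0 : 0 <= 2 * PI) by lra.
      pose proof (Cg _ (INR n) HF1) as CA. pose proof (Cg _ (INR (S n)) HF) as CB.
      rewrite <- (cint_Cmult (Ci * RtoC r) _ _ _ Hpi0 CA), <- (cint_Cmult (Ci * RtoC (- INR (S n))) _ _ _ Hpi0 CB).
      rewrite <- (cint_plus _ _ _ _ Hpi0).
      2: intros t Ht; apply continuous_Cmult; [apply continuous_const | exact (CA t Ht)].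
      2: intros t Ht; apply continuous_Cmult; [apply continuous_const | exact (CB t Ht)].
      assert (Eq : forall s,
        (Ci * RtoC r * (d1 F (circ (fst z) r s, snd z) * expi (- INR n * s))
          + Ci * RtoC (- INR (S n)) * (F (circ (fst z) r s, snd z) * expi (- INR (S n) * s))
        = d1 F (circ (fst z) r s, snd z) * (RtoC r * (Ci * expi s)) * expi (- INR (S n) * s)
          + F (circ (fst z) r s, snd z) * (Ci * RtoC (- INR (S n)) * expi (- INR (S n) * s)))%C).
      { intros s. rewrite S_INR. replace (- INR n * s) with (s + - (INR n + 1) * s) by ring.
        rewrite expi_plus. ring. }
      rewrite (cint_ext _ _ 0 (2 * PI) ltac:(lra) (fun s _ => Eq s)).
      rewrite (cint_rder (fun t => F (circ (fst z) r t, snd z) * expi (- INR (S n) * t))%C); try lra.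
      - rewrite circ_2PI. replace (- INR (S n) * (2 * PI)) with (- (INR (S n) * (2 * PI))) by ring.
        rewrite expi_opp_2PI, Rmult_0_r. unfold expi. rewrite cos_0, sin_0. fold (RtoC 1). ring.
      - intros t _.
        apply (rder_mult (fun t => F (circ (fst z) r t, snd z)) (fun t => expi (- INR (S n) * t)));
          [|apply rder_expi].
        apply (cder_rder_comp (fun w => F (w, snd z)) (circ (fst z) r)); [apply rder_circ|].
        apply (HF _ (Bi t)).
      - intros t Ht. apply (continuous_ext _ _ t Eq).
        apply continuous_Cplus; (apply continuous_Cmult; [apply continuous_const | now apply Cg]). }
    assert (Hn : 0 < INR (S n)) by (apply lt_0_INR; lia).
    assert (HB : B = (RtoC (r / INR (S n)) * A)%C).
    { assert (Hnc : RtoC (INR (S n)) <> 0) by (intros E; apply RtoC_inj in E; lra).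
      assert (E : (RtoC r * A - RtoC (INR (S n)) * B)%C = 0).
      { transitivity (- Ci * (Ci * RtoC r * A + Ci * RtoC (- INR (S n)) * B))%C; [|rewrite Parts; ring].
        rewrite RtoC_opp.
        replace (RtoC r * A - RtoC (INR (S n)) * B)%C with (1 * (RtoC r * A - RtoC (INR (S n)) * B))%C by ring.
        replace (RtoC 1) with (- Ci * Ci)%C by (unfold Ci, Copp, Cmult, RtoC; simpl; f_equal; ring). ring. }
      rewrite RtoC_div by lra.
      transitivity ((RtoC r * A - (RtoC r * A - RtoC (INR (S n)) * B)) / RtoC (INR (S n)))%C.
      - field. trivial.
      - rewrite E. field. trivial. }
    rewrite HB. unfold A. rewrite (IH (d1 F) z r); trivial; [|now apply holomorphic_d1].
    rewrite Nat.iter_succ_r, Cmult_assoc, <- RtoC_mult. f_equal. f_equal.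
    rewrite fact_simpl, mult_INR. simpl pow. field. split; [apply INR_fact_neq_0 | lra].
Qed.

Lemma cauchy_estimate_d1 F z r M n :
  holomorphic_bidisc F -> 0 < r -> Cmod (fst z) + r < 1 -> Cmod (snd z) < 1 ->
  (forall w, Cmod (w - fst z)%C <= r -> Cmod (F (w, snd z)) <= M) ->
  Cmod (Nat.iter n d1 F z) / INR (fact n) * r ^ n <= M.
Proof.
  intros HF Hr H1 H2 HM. pose proof PI_RGT_0.
  pose proof (INR_fact_lt_0 n) as Hf. pose proof (pow_lt r n Hr) as Hp.
  pose proof (cauchy_coefficient n F z r HF Hr H1 H2) as E.
  assert (B : Cmod (cint (fun t => F (circ (fst z) r t, snd z) * expi (- INR n * t))%C 0 (2 * PI))
              <= (2 * PI - 0) * M).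
  { apply cint_Cmod_le; [lra| |].
    - intros t _. apply continuous_Cmult; [|apply continuous_expi].
      apply (continuous_comp (circ (fst z) r) (fun w => F (w, snd z))); [apply continuous_circ|].
      eapply cder_continuous. apply (HF (circ (fst z) r t, snd z)). split; trivial. now apply circle_in_disc.
    - intros t _. rewrite Cmod_mult, Cmod_expi, Rmult_1_r. apply HM. rewrite Cmod_circ; lra. }
  rewrite E, Cmod_mult, Cmod_R, Rabs_right in B.
  - apply Rmult_le_reg_l with (2 * PI); [lra|].
    eapply Rle_trans; [|eapply Rle_trans; [exact B|]]; [|lra].
    right. field. lra.
  - apply Rle_ge, Rdiv_le_0_compat; [|lra]. apply Rmult_le_pos; lra.
Qed.

Lemma iter_d2_swap n F z :
  Nat.iter n d2 F z = Nat.iter n d1 (swap_args F) (snd z, fst z).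
Proof.
  revert z. induction n as [|n IH]; intros z.
  - now destruct z.
  - simpl. unfold d1 at 1, d2 at 1. f_equal.
    apply functional_extensionality. intros w. apply IH.
Qed.

Lemma cauchy_estimate_d2 F z r M n :
  holomorphic_bidisc F -> 0 < r -> Cmod (fst z) < 1 -> Cmod (snd z) + r < 1 ->
  (forall w, Cmod (w - snd z)%C <= r -> Cmod (F (fst z, w)) <= M) ->
  Cmod (Nat.iter n d2 F z) / INR (fact n) * r ^ n <= M.
Proof.
  intros HF Hr H1 H2 HM. rewrite iter_d2_swap.
  apply cauchy_estimate_d1; trivial. now apply holomorphic_swap.
Qed.

(** One variable at a time: the estimate in the first variable, at every [w] of the second disc,
    bounds the [p]-fold [d1] by [M * p! / r1^p]; this is the bound to which the estimate in the
    second variable is applied. *)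
Lemma cauchy_estimate F z r1 r2 M p q :
  holomorphic_bidisc F -> 0 < r1 -> 0 < r2 -> Cmod (fst z) + r1 < 1 -> Cmod (snd z) + r2 < 1 ->
  (forall w, bidisc w -> cpolydisc z r1 r2 w -> Cmod (F w) <= M) ->
  Cmod (pderiv F p q z) / (INR (fact p) * INR (fact q)) * (r1 ^ p * r2 ^ q) <= M.
Proof.
  intros HF Hr1 Hr2 H1 H2 HM.
  pose proof (INR_fact_lt_0 p) as Fp. pose proof (INR_fact_lt_0 q) as Fq.
  pose proof (pow_lt r1 p Hr1) as Pp. pose proof (pow_lt r2 q Hr2) as Pq.
  set (N := INR (fact p) / r1 ^ p).
  assert (HN : 0 < N) by now apply Rdiv_lt_0_compat.
  assert (E : Cmod (pderiv F p q z) / INR (fact q) * r2 ^ q <= M * N).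
  { apply cauchy_estimate_d2; trivial; [now apply holomorphic_iter_d1 | lra |].
    intros w Hw.
    assert (Hw1 : Cmod w < 1) by (eapply disc_center; eassumption).
    assert (E1 : Cmod (Nat.iter p d1 F (fst z, w)) / INR (fact p) * r1 ^ p <= M).
    { apply cauchy_estimate_d1; trivial. intros v Hv. apply HM; split; simpl; trivial.
      now apply (disc_center (fst z) v r1). }
    apply Rmult_le_compat_r with (r := N) in E1; [|lra].
    eapply Rle_trans; [|exact E1]. right. unfold N. field. lra. }
  apply Rmult_le_reg_r with N; trivial. eapply Rle_trans; [|exact E].
  right. unfold N. field. lra.
Qed.

(** * A Gronwall inequality for finite systems *)

(** Moduli and their maximum need not be differentiable, whereas the sum of squared moduli is, and
    it controls the maximum up to the length of the list. *)
Definition sum_sq {I : Type} (a : I -> R -> C) (l : list I) (t : R) : R :=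
  fold_right (fun i acc => Cmod (a i t) ^ 2 + acc) 0 l.

Lemma sum_sq_ge0 {I : Type} (a : I -> R -> C) l t : 0 <= sum_sq a l t.
Proof.
  induction l as [|i l IH]; simpl; [lra|]. apply Rplus_le_le_0_compat; trivial.
  change (0 <= Cmod (a i t) ^ 2). apply pow2_ge_0.
Qed.

Lemma sum_sq_ge {I : Type} (a : I -> R -> C) l t i :
  In i l -> Cmod (a i t) ^ 2 <= sum_sq a l t.
Proof.
  induction l as [|j l IH]; [easy|]. pose proof (sum_sq_ge0 a l t) as H0.
  intros [->|H].
  - change (Cmod (a i t) ^ 2 <= Cmod (a i t) ^ 2 + sum_sq a l t). lra.
  - specialize (IH H). change (Cmod (a i t) ^ 2 <= Cmod (a j t) ^ 2 + sum_sq a l t).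
    pose proof (pow2_ge_0 (Cmod (a j t))). lra.
Qed.

Lemma sum_sq_le {I : Type} (a : I -> R -> C) l t m :
  (forall i, In i l -> Cmod (a i t) <= m) -> sum_sq a l t <= INR (length l) * m ^ 2.
Proof.
  induction l as [|i l IH]; intros H; [simpl; lra|].
  change (Cmod (a i t) ^ 2 + sum_sq a l t <= INR (S (length l)) * m ^ 2).
  rewrite S_INR. specialize (IH (fun j Hj => H j (or_intror Hj))).
  assert (Cmod (a i t) ^ 2 <= m ^ 2).
  { apply pow_incr. split; [apply Cmod_ge_0 | apply H; now left]. }
  lra.
Qed.

(** Each term of the derivative is twice the real scalar product of [a] and [a'], hence at most
    [|a|^2 + |a'|^2]. *)
Lemma is_derive_sum_sq {I : Type} (a da : I -> R -> C) (l : list I) (K t : R) :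
  0 <= K -> (forall i, In i l -> rder (a i) t (da i t) /\ Cmod (da i t) <= K) ->
  exists d, is_derive (sum_sq a l) t d /\ d <= INR (length l) * K ^ 2 + sum_sq a l t.
Proof.
  intros HK. induction l as [|i l IH]; intros H.
  - exists 0. split; [|simpl; lra]. apply (is_derive_const (V := R_NormedModule) 0).
  - destruct (IH (fun j Hj => H j (or_intror Hj))) as [d [Hd Bd]].
    destruct (H i (or_introl eq_refl)) as [[D1 D2] Bi].
    assert (Di : is_derive (fun s => Cmod (a i s) ^ 2) t
      (2 * (fst (a i t) * fst (da i t) + snd (a i t) * snd (da i t)))).
    { apply (is_derive_ext (fun s => fst (a i s) * fst (a i s) + snd (a i s) * snd (a i s))).
      { intros s. rewrite Cmod2_alt. unfold Re, Im. simpl. ring. }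
      replace (2 * (fst (a i t) * fst (da i t) + snd (a i t) * snd (da i t)))
        with ((fst (da i t) * fst (a i t) + fst (a i t) * fst (da i t)) +
              (snd (da i t) * snd (a i t) + snd (a i t) * snd (da i t))) by ring.
      apply (is_derive_plus (V := R_NormedModule) (fun s => fst (a i s) * fst (a i s)) (fun s => snd (a i s) * snd (a i s)));
        apply (is_derive_mult (K := R_AbsRing)); trivial; exact Rmult_comm. }
    exists (2 * (fst (a i t) * fst (da i t) + snd (a i t) * snd (da i t)) + d). split.
    + apply (is_derive_plus (V := R_NormedModule) (fun s => Cmod (a i s) ^ 2) (sum_sq a l)); trivial.
    + change (2 * (fst (a i t) * fst (da i t) + snd (a i t) * snd (da i t)) + d
        <= INR (S (length l)) * K ^ 2 + (Cmod (a i t) ^ 2 + sum_sq a l t)).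
      rewrite S_INR.
      assert (B2 : Cmod (da i t) ^ 2 <= K ^ 2) by (apply pow_incr; split; [apply Cmod_ge_0 | trivial]).
      rewrite !Cmod2_alt in *. unfold Re, Im in *.
      pose proof (pow2_ge_0 (fst (a i t) - fst (da i t))).
      pose proof (pow2_ge_0 (snd (a i t) - snd (da i t))). nra.
Qed.

(** The dominating index [j] may depend on [i] and [t], but every [|a_j|] is at most the square root
    of the sum [S]. So [S' <= L S] with [L = INR (length l) * K ^ 2 + 1], and [S e^(-Lt)] does not
    increase. *)
Lemma gronwall {I : Type} (a da : I -> R -> C) (l : list I) (K : R) :
  0 <= K ->
  (forall i t, In i l -> 0 <= t <= 1 ->
     rder (a i) t (da i t) /\ exists j, In j l /\ Cmod (da i t) <= K * Cmod (a j t)) ->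
  sum_sq a l 1 <= exp (INR (length l) * K ^ 2 + 1) * sum_sq a l 0.
Proof.
  intros HK H. set (L := INR (length l) * K ^ 2 + 1).
  assert (HS : forall t, 0 <= t <= 1 ->
    exists d, is_derive (sum_sq a l) t d /\ d <= L * sum_sq a l t).
  { intros t Ht. pose proof (sum_sq_ge0 a l t) as H0.
    set (s := sqrt (sum_sq a l t)).
    assert (Hs : s ^ 2 = sum_sq a l t) by (unfold s; now apply pow2_sqrt).
    destruct (is_derive_sum_sq a da l (K * s) t) as [d [Hd Bd]].
    - apply Rmult_le_pos; trivial. apply sqrt_pos.
    - intros i Hi. destruct (H i t Hi Ht) as [H1 [j [Hj H2]]]. split; trivial.
      eapply Rle_trans; [exact H2|]. apply Rmult_le_compat_l; trivial.
      unfold s. rewrite <- (sqrt_pow2 (Cmod (a j t))) by apply Cmod_ge_0.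
      apply sqrt_le_1_alt. now apply sum_sq_ge.
    - exists d. split; trivial. rewrite Rpow_mult_distr, Hs in Bd. unfold L. lra. }
  set (phi := fun t => sum_sq a l t * exp (- L * t)).
  assert (Hexp : forall t, is_derive (fun s => exp (- L * s)) t (- L * exp (- L * t))).
  { intros t. auto_derive; trivial. ring. }
  assert (Hphi : forall t, 0 <= t <= 1 -> exists d, is_derive phi t d /\ d <= 0).
  { intros t Ht. destruct (HS t Ht) as [d [Hd Bd]].
    exists (d * exp (- L * t) + sum_sq a l t * (- L * exp (- L * t))). split.
    - apply (is_derive_mult (K := R_AbsRing) (sum_sq a l) (fun s => exp (- L * s))); trivial. exact Rmult_comm.
    - pose proof (exp_pos (- L * t)). nra. }
  destruct (MVT_gen phi 0 1 (Derive phi)) as [c [Hc Heq]].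
  { intros t Ht. rewrite Rmin_left, Rmax_right in Ht by lra.
    destruct (Hphi t ltac:(lra)) as [d [Hd _]]. apply Derive_correct. now exists d. }
  { intros t Ht. rewrite Rmin_left, Rmax_right in Ht by lra.
    destruct (Hphi t Ht) as [d [Hd _]].
    apply continuity_pt_filterlim, (ex_derive_continuous (K := R_AbsRing) (V := R_NormedModule)).
    now exists d. }
  rewrite Rmin_left, Rmax_right in Hc by lra.
  destruct (Hphi c Hc) as [d [Hd Bd]]. rewrite (is_derive_unique _ _ _ Hd) in Heq.
  assert (Hle : phi 1 <= phi 0) by lra.
  unfold phi in Hle. rewrite Rmult_0_r, exp_0, !Rmult_1_r in Hle.
  apply Rmult_le_compat_l with (r := exp L) in Hle; [|left; apply exp_pos].
  eapply Rle_trans; [|exact Hle]. right.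
  rewrite (Rmult_comm (sum_sq a l 1)), <- Rmult_assoc, <- exp_plus.
  rewrite Rplus_opp_r, exp_0. ring.
Qed.

(** * Bounded index *)

Lemma list_argmax {I : Type} (f : I -> R) (l : list I) :
  l <> nil -> exists i, In i l /\ forall j, In j l -> f j <= f i.
Proof.
  induction l as [|i l IH]; intros H; [easy|].
  destruct l as [|i' l'].
  - exists i. split; [now left|]. intros j [->|[]]. lra.
  - destruct IH as [m [Hm1 Hm2]]; [easy|].
    destruct (Rle_dec (f m) (f i)) as [Hle|Hle].
    + exists i. split; [now left|]. intros j [->|Hj]; [lra|]. specialize (Hm2 j Hj). lra.
    + exists m. split; [now right|]. intros j [->|Hj]; [lra|]. now apply Hm2.
Qed.

(** Supplies the pair [(k01, k02)] of the local bound: the order at which the normalized derivative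
    at [z0] is largest. *)
Lemma finite_index_argmax (f : nat -> nat -> R) (N : nat) :
  exists k1 k2, (k1 + k2 <= N)%nat /\ forall j1 j2, (j1 + j2 <= N)%nat -> f j1 j2 <= f k1 k2.
Proof.
  set (l := filter (fun p => (fst p + snd p <=? N)%nat) (list_prod (seq 0 (S N)) (seq 0 (S N)))).
  assert (Hl : forall j1 j2, In (j1, j2) l <-> (j1 + j2 <= N)%nat).
  { intros j1 j2. unfold l. rewrite filter_In, in_prod_iff, !in_seq. simpl fst; simpl snd.
    rewrite Nat.leb_le. lia. }
  destruct (list_argmax (fun p => f (fst p) (snd p)) l) as [[k1 k2] [Hk1 Hk2]].
  - intros E. assert (H0 : In (0, 0)%nat l) by (apply Hl; lia). now rewrite E in H0.
  - exists k1, k2. split; [now apply Hl|]. intros j1 j2 Hj. apply (Hk2 (j1, j2)). now apply Hl.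
Qed.

(* [nder] with the weights [l1 z, l2 z] replaced by constants [x, y]. *)
Definition wder (F : C * C -> C) (x y : R) (p q : nat) (w : C * C) : R :=
  Cmod (pderiv F p q w) / (INR (fact p) * INR (fact q) * x ^ p * y ^ q).

Lemma weight_pos p q x y : 0 < x -> 0 < y -> 0 < INR (fact p) * INR (fact q) * x ^ p * y ^ q.
Proof.
  intros Hx Hy. pose proof (INR_fact_lt_0 p). pose proof (INR_fact_lt_0 q).
  pose proof (pow_lt x p Hx). pose proof (pow_lt y q Hy). repeat apply Rmult_lt_0_compat; trivial.
Qed.

Lemma wder_ge0 F x y p q w : 0 < x -> 0 < y -> 0 <= wder F x y p q w.
Proof. intros Hx Hy. apply Rdiv_le_0_compat; [apply Cmod_ge_0 | now apply weight_pos]. Qed.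

Lemma wder_change F x y u v p q w :
  0 < x -> 0 < y -> 0 < u -> 0 < v ->
  wder F x y p q w = wder F u v p q w * ((u / x) ^ p * (v / y) ^ q).
Proof.
  intros Hx Hy Hu Hv. unfold wder, Rdiv. rewrite !Rpow_mult_distr, !pow_inv.
  pose proof (INR_fact_lt_0 p). pose proof (INR_fact_lt_0 q).
  pose proof (pow_lt x p Hx). pose proof (pow_lt y q Hy).
  pose proof (pow_lt u p Hu). pose proof (pow_lt v q Hv). field. lra.
Qed.

Lemma pow_le_anti c n m : 0 < c <= 1 -> (n <= m)%nat -> c ^ m <= c ^ n.
Proof.
  intros Hc Hnm. replace m with (n + (m - n))%nat by lia. rewrite pow_add.
  pose proof (pow_lt c n ltac:(lra)). pose proof (pow_incr c 1 (m - n) ltac:(lra)) as H1.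
  rewrite pow1 in H1. nra.
Qed.

(** Each order contributes one ratio of weights; since [1 <= K], the single power [K ^ M] serves all
    orders up to [M]. The companion below does the same with a lower bound [c <= 1]. *)
Lemma wder_change_le F x y u v p q w K M :
  0 < x -> 0 < y -> 0 < u -> 0 < v -> 1 <= K -> u / x <= K -> v / y <= K -> (p + q <= M)%nat ->
  wder F x y p q w <= wder F u v p q w * K ^ M.
Proof.
  intros Hx Hy Hu Hv HK H1 H2 HM. rewrite (wder_change F x y u v) by trivial.
  apply Rmult_le_compat_l; [now apply wder_ge0|].
  apply Rle_trans with (K ^ p * K ^ q).
  - apply Rmult_le_compat; try (apply pow_le; left; now apply Rdiv_lt_0_compat);
      apply pow_incr; split; trivial; left; now apply Rdiv_lt_0_compat.
  - rewrite <- pow_add. now apply Rle_pow.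
Qed.

Lemma wder_change_ge F x y u v p q w c M :
  0 < x -> 0 < y -> 0 < u -> 0 < v -> 0 < c <= 1 -> c <= u / x -> c <= v / y -> (p + q <= M)%nat ->
  wder F u v p q w <= wder F x y p q w / c ^ M.
Proof.
  intros Hx Hy Hu Hv Hc H1 H2 HM. pose proof (pow_lt c M ltac:(lra)) as HcM.
  apply (proj1 (Rle_div_r _ _ _ HcM)). rewrite (wder_change F x y u v) by trivial.
  apply Rmult_le_compat_l; [now apply wder_ge0|].
  apply Rle_trans with (c ^ p * c ^ q).
  - rewrite <- pow_add. now apply pow_le_anti.
  - apply Rmult_le_compat; try (apply pow_le; lra); apply pow_incr; lra.
Qed.

(** The lower bound on [l_j], solved for [beta / l_j], says that the closed polydisc of these radii
    stays inside the bidisc. *)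
Lemma admissible_pos beta l1 l2 z :
  1 < beta -> admissible_L beta l1 l2 -> bidisc z ->
  0 < l1 z /\ 0 < l2 z /\ Cmod (fst z) + beta / l1 z < 1 /\ Cmod (snd z) + beta / l2 z < 1.
Proof.
  intros Hb HL [Hz1 Hz2]. destruct (HL z (conj Hz1 Hz2)) as (_ & _ & _ & _ & H1 & H2).
  assert (P : forall m l, m < 1 -> l > beta / (1 - m) -> 0 < l /\ m + beta / l < 1).
  { intros m l Hm Hl. assert (0 < beta / (1 - m)) by (apply Rdiv_lt_0_compat; lra).
    assert (Hl0 : 0 < l) by lra. split; trivial.
    assert (beta / l < 1 - m); [|lra].
    apply Rlt_div_l; [lra|]. apply Rgt_lt, Rlt_div_l in Hl; lra. }
  destruct (P _ _ Hz1 H1). destruct (P _ _ Hz2 H2). tauto.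
Qed.

Lemma pow_unbounded b M : 1 < b -> exists n, M <= b ^ n.
Proof.
  intros Hb. destruct (Pow_x_infinity b ltac:(rewrite Rabs_right; lra) M) as [n Hn].
  exists n. specialize (Hn n (Nat.le_refl n)). rewrite Rabs_right in Hn; [lra|].
  apply Rle_ge, pow_le. lra.
Qed.

Lemma index_of_local_bound (beta : R) (l1 l2 : C * C -> R) (F : C * C -> C) (n0 : nat) (p0 : R) :
  1 < beta -> admissible_L beta l1 l2 -> holomorphic_bidisc F -> 0 < p0 ->
  (forall z0, bidisc z0 -> exists k1 k2, (k1 + k2 <= n0)%nat /\
     forall z, bidisc z -> cpolydisc z0 (beta / l1 z0) (beta / l2 z0) z ->
       Cmod (F z) <= p0 * nder F l1 l2 k1 k2 z0) ->
  bounded_L_index F l1 l2.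
Proof.
  intros Hb HL HF Hp0 H.
  destruct (pow_unbounded beta p0 Hb) as [m Hm].
  (* Orders up to [n0 + m] are compared with themselves; beyond that [beta ^ (p + q)] has outgrown
     [p0]. *)
  exists (n0 + m)%nat. intros z Hz p q.
  destruct (le_gt_dec (p + q) (n0 + m)) as [Hpq|Hpq].
  { exists p, q. split; trivial. lra. }
  destruct (H z Hz) as (k1 & k2 & Hk & HM).
  exists k1, k2. split; [lia|].
  destruct (admissible_pos beta l1 l2 z Hb HL Hz) as (P1 & P2 & D1 & D2).
  assert (B1 : 0 < beta / l1 z) by (apply Rdiv_lt_0_compat; lra).
  assert (B2 : 0 < beta / l2 z) by (apply Rdiv_lt_0_compat; lra).
  pose proof (cauchy_estimate F z _ _ _ p q HF B1 B2 D1 D2 HM) as HC.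
  set (x := nder F l1 l2 k1 k2 z) in *.
  assert (Hx : 0 <= x) by now apply (wder_ge0 F (l1 z) (l2 z)).
  assert (E : Cmod (pderiv F p q z) / (INR (fact p) * INR (fact q)) * ((beta / l1 z) ^ p * (beta / l2 z) ^ q)
    = nder F l1 l2 p q z * beta ^ (p + q)).
  { unfold nder, Rdiv. rewrite !Rpow_mult_distr, !pow_inv, pow_add.
    pose proof (INR_fact_lt_0 p). pose proof (INR_fact_lt_0 q).
    pose proof (pow_lt _ p P1). pose proof (pow_lt _ q P2). field. lra. }
  rewrite E in HC.
  assert (Hbig : p0 <= beta ^ (p + q)).
  { eapply Rle_trans; [exact Hm|]. apply Rle_pow; [lra | lia]. }
  apply Rmult_le_reg_r with (beta ^ (p + q)); [lra|].
  eapply Rle_trans; [exact HC|]. rewrite (Rmult_comm x). now apply Rmult_le_compat_r.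
Qed.

(** * The system with frozen weights along axis-parallel legs *)

(** A complex-valued function with modulus [wder]; along a leg these are the unknowns of the
    Gronwall system. *)
Definition wfun (F : C * C -> C) (x y : R) (k : nat * nat) (w : C * C) : C :=
  (RtoC (/ (INR (fact (fst k)) * INR (fact (snd k)) * x ^ fst k * y ^ snd k))
   * pderiv F (fst k) (snd k) w)%C.

Lemma Cmod_wfun F x y k w : 0 < x -> 0 < y -> Cmod (wfun F x y k w) = wder F x y (fst k) (snd k) w.
Proof.
  intros Hx Hy. unfold wfun, wder. pose proof (weight_pos (fst k) (snd k) x y Hx Hy).
  rewrite Cmod_mult, Cmod_R, Rabs_right.
  - unfold Rdiv. ring.
  - apply Rle_ge. left. now apply Rinv_0_lt_compat.
Qed.

(** Passing from the normalization [p! x^p] to [(p + 1)! x^(p + 1)] costs exactly [x * (p + 1)]; the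
    factor [v - u] is the velocity along the leg. *)
Lemma rder_wfun_1 F x y p q (u v w : C) t :
  holomorphic_bidisc F -> 0 < x -> 0 < y -> bidisc (u + RtoC t * (v - u), w)%C ->
  rder (fun s => wfun F x y (p, q) (u + RtoC s * (v - u), w)%C) t
    (RtoC (x * INR (S p)) * (v - u) * wfun F x y (S p, q) (u + RtoC t * (v - u), w))%C.
Proof.
  intros HF Hx Hy Hw. pose proof (holomorphic_pderiv F p q HF) as Hpq.
  set (W := RtoC (/ (INR (fact p) * INR (fact q) * x ^ p * y ^ q))).
  replace (RtoC (x * INR (S p)) * (v - u) * wfun F x y (S p, q) (u + RtoC t * (v - u), w))%C
    with ((0 * pderiv F p q (u + RtoC t * (v - u), w) + W * d1 (pderiv F p q) (u + RtoC t * (v - u), w)) * (v - u))%C.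
  - apply (cder_rder_comp (fun s => wfun F x y (p, q) (s, w)) (fun s => u + RtoC s * (v - u))%C).
    + apply rder_segment.
    + apply (cder_mult (fun _ => W) (fun s => pderiv F p q (s, w))); [apply cder_const|].
      apply (Hpq _ Hw).
  - rewrite d1_pderiv by trivial. unfold wfun; simpl fst; simpl snd.
    replace W with (RtoC (x * INR (S p)) * RtoC (/ (INR (fact (S p)) * INR (fact q) * x ^ S p * y ^ q)))%C; [ring|].
    unfold W. rewrite <- RtoC_mult. f_equal. rewrite fact_simpl, mult_INR. simpl pow.
    pose proof (INR_fact_lt_0 p). pose proof (INR_fact_lt_0 q).
    pose proof (pow_lt _ p Hx). pose proof (pow_lt _ q Hy).
    assert (0 < INR (S p)) by (apply lt_0_INR; lia). field. lra.
Qed.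

Lemma rder_wfun_2 F x y p q (u v w : C) t :
  holomorphic_bidisc F -> 0 < x -> 0 < y -> bidisc (w, u + RtoC t * (v - u))%C ->
  rder (fun s => wfun F x y (p, q) (w, u + RtoC s * (v - u))%C) t
    (RtoC (y * INR (S q)) * (v - u) * wfun F x y (p, S q) (w, u + RtoC t * (v - u)))%C.
Proof.
  intros HF Hx Hy Hw. pose proof (holomorphic_pderiv F p q HF) as Hpq.
  set (W := RtoC (/ (INR (fact p) * INR (fact q) * x ^ p * y ^ q))).
  replace (RtoC (y * INR (S q)) * (v - u) * wfun F x y (p, S q) (w, u + RtoC t * (v - u)))%C
    with ((0 * pderiv F p q (w, u + RtoC t * (v - u)) + W * d2 (pderiv F p q) (w, u + RtoC t * (v - u))) * (v - u))%C.
  - apply (cder_rder_comp (fun s => wfun F x y (p, q) (w, s)) (fun s => u + RtoC s * (v - u))%C).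
    + apply rder_segment.
    + apply (cder_mult (fun _ => W) (fun s => pderiv F p q (w, s))); [apply cder_const|].
      apply (Hpq _ Hw).
  - change (d2 (pderiv F p q)) with (pderiv F p (S q)). unfold wfun; simpl fst; simpl snd.
    replace W with (RtoC (y * INR (S q)) * RtoC (/ (INR (fact p) * INR (fact (S q)) * x ^ p * y ^ S q)))%C; [ring|].
    unfold W. rewrite <- RtoC_mult. f_equal. rewrite fact_simpl, mult_INR. simpl pow.
    pose proof (INR_fact_lt_0 p). pose proof (INR_fact_lt_0 q).
    pose proof (pow_lt _ p Hx). pose proof (pow_lt _ q Hy).
    assert (0 < INR (S q)) by (apply lt_0_INR; lia). field. lra.
Qed.

Lemma Cmod_segment (u v : C) t m :
  0 <= t <= 1 -> Cmod u < m -> Cmod v < m -> Cmod (u + RtoC t * (v - u))%C < m.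
Proof.
  intros Ht Hu Hv. replace (u + RtoC t * (v - u))%C with (RtoC (1 - t) * u + RtoC t * v)%C
    by (rewrite RtoC_minus; ring).
  eapply Rle_lt_trans; [apply Cmod_triangle|]. rewrite !Cmod_mult, !Cmod_R, !Rabs_right by lra.
  pose proof (Cmod_ge_0 u). pose proof (Cmod_ge_0 v).
  (* Strictness comes from [u] when [t = 0] and from [v] when [t > 0]. *)
  destruct (Rle_lt_dec t 0); nra.
Qed.

Lemma Cmod_segment_dist (u v : C) t m :
  0 <= t <= 1 -> Cmod (v - u)%C <= m -> Cmod (u + RtoC t * (v - u) - u)%C <= m.
Proof.
  intros Ht Hm. replace (u + RtoC t * (v - u) - u)%C with (RtoC t * (v - u))%C by ring.
  rewrite Cmod_mult, Cmod_R, Rabs_right by lra. pose proof (Cmod_ge_0 (v - u)%C). nra.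
Qed.

(** The index set of the system. It contains every order [k1 + k2 <= N] that the index bound can
    return, and one differentiation leaves it by at most one step in one direction. *)
Definition index_square (N : nat) : list (nat * nat) := list_prod (seq 0 (S N)) (seq 0 (S N)).

Lemma in_index_square N p q : In (p, q) (index_square N) <-> (p <= N /\ q <= N)%nat.
Proof. unfold index_square. rewrite in_prod_iff, !in_seq. lia. Qed.

(* The polydisc is a product, so [z] is reached from [z0] by two axis-parallel legs. *)
Lemma polydisc_growth F x y r1 r2 D b z0 z N :
  holomorphic_bidisc F -> 0 < x -> 0 < y -> 0 <= r1 <= b -> 0 <= r2 <= b -> 0 <= D ->
  bidisc z0 -> bidisc z -> cpolydisc z0 (r1 / x) (r2 / y) z ->
  (forall w p q, bidisc w -> cpolydisc z0 (r1 / x) (r2 / y) w -> (p <= S N)%nat -> (q <= S N)%nat ->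
     exists k1 k2, (k1 + k2 <= N)%nat /\ wder F x y p q w <= D * wder F x y k1 k2 w) ->
  let l := index_square N in
  let K := b * INR (S N) * D in
  sum_sq (fun k _ => wfun F x y k z) l 0 <=
  exp (2 * (INR (length l) * K ^ 2 + 1)) * sum_sq (fun k _ => wfun F x y k z0) l 0.
Proof.
  intros HF Hx Hy Hr1 Hr2 HD Hz0 Hz Hpoly Hidx l K.
  destruct z0 as [u1 u2]. destruct z as [v1 v2].
  destruct Hz0 as [U1 U2]. destruct Hz as [V1 V2]. destruct Hpoly as [Q1 Q2]. simpl in U1, U2, V1, V2, Q1, Q2.
  assert (HN : 0 < INR (S N)) by (apply lt_0_INR; lia).
  assert (HK : 0 <= K) by (unfold K; repeat apply Rmult_le_pos; lra).
  assert (Hr1x : 0 <= r1 / x) by (apply Rdiv_le_0_compat; lra).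
  assert (Hr2y : 0 <= r2 / y) by (apply Rdiv_le_0_compat; lra).
  (* The weight [s] produced by differentiation meets a leg of length at most [r / s], so the
     coefficient is at most [b * INR (S N)], whatever the weight. *)
  assert (Coef : forall (s r : R) (d : C) (p : nat) (A B : R),
    0 < s -> 0 <= r <= b -> Cmod d <= r / s -> (p <= N)%nat -> 0 <= B -> A <= D * B ->
    0 <= A -> s * INR (S p) * Cmod d * A <= K * B).
  { intros s r d p A B Hs Hr Hd Hp HB HAB HA.
    assert (H1 : s * Cmod d <= b).
    { apply Rle_trans with (s * (r / s)); [apply Rmult_le_compat_l; lra|].
      replace (s * (r / s)) with r by (field; lra). lra. }
    assert (H2 : INR (S p) <= INR (S N)) by (apply le_INR; lia).
    replace (s * INR (S p) * Cmod d * A) with ((s * Cmod d) * INR (S p) * A) by ring.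
    replace (K * B) with (b * INR (S N) * (D * B)) by (unfold K; ring).
    assert (0 <= s * Cmod d) by (apply Rmult_le_pos; [lra | apply Cmod_ge_0]).
    pose proof (pos_INR (S p)).
    apply Rmult_le_compat; trivial; [now apply Rmult_le_pos|].
    now apply Rmult_le_compat. }
  assert (Leg1 := gronwall (fun k t => wfun F x y k (u1 + RtoC t * (v1 - u1), u2)%C)
    (fun k t => RtoC (x * INR (S (fst k))) * (v1 - u1) * wfun F x y (S (fst k), snd k) (u1 + RtoC t * (v1 - u1), u2))%C l K HK).
  assert (Leg2 := gronwall (fun k t => wfun F x y k (v1, u2 + RtoC t * (v2 - u2))%C)
    (fun k t => RtoC (y * INR (S (snd k))) * (v2 - u2) * wfun F x y (fst k, S (snd k)) (v1, u2 + RtoC t * (v2 - u2)))%C l K HK).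
  assert (E : forall u v : C, (u + RtoC 0 * (v - u) = u /\ u + RtoC 1 * (v - u) = v)%C).
  { intros u v. split; ring. }
  (* The end of the first leg is the start of the second, so the two estimates chain; this is the
     factor [2] in the exponent. *)
  unfold sum_sq in Leg1, Leg2. rewrite (proj1 (E u1 v1)), (proj2 (E u1 v1)) in Leg1.
  rewrite (proj1 (E u2 v2)), (proj2 (E u2 v2)) in Leg2.
  replace (2 * (INR (length l) * K ^ 2 + 1)) with ((INR (length l) * K ^ 2 + 1) + (INR (length l) * K ^ 2 + 1)) by ring.
  rewrite exp_plus, Rmult_assoc.
  eapply Rle_trans; [apply Leg2 | apply Rmult_le_compat_l; [left; apply exp_pos | apply Leg1]].
  - intros [p q] t Hk Ht. apply in_index_square in Hk. destruct Hk as [Hp Hq].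
    assert (Bw : bidisc (v1, u2 + RtoC t * (v2 - u2))%C).
    { split; trivial. now apply Cmod_segment. }
    split; [now apply rder_wfun_2|].
    (* Here [S q] may be [S N], just outside the square; the domination hypothesis leads back into
       it. *)
    destruct (Hidx (v1, u2 + RtoC t * (v2 - u2))%C p (S q) Bw) as (k1 & k2 & Hk & Hle).
    { split; trivial. now apply Cmod_segment_dist. }
    { lia. } { lia. }
    exists (k1, k2). split; [apply in_index_square; lia|].
    rewrite !Cmod_mult, Cmod_R, !Cmod_wfun, Rabs_right by first [assumption | apply Rle_ge, Rmult_le_pos; [lra | apply pos_INR]].
    apply Coef with r2; trivial; now apply wder_ge0.
  - intros [p q] t Hk Ht. apply in_index_square in Hk. destruct Hk as [Hp Hq].
    assert (Bw : bidisc (u1 + RtoC t * (v1 - u1), u2)%C).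
    { split; trivial. now apply Cmod_segment. }
    split; [now apply rder_wfun_1|].
    destruct (Hidx (u1 + RtoC t * (v1 - u1), u2)%C (S p) q Bw) as (k1 & k2 & Hk & Hle).
    { split; [now apply Cmod_segment_dist|]. simpl. replace (u2 - u2)%C with (RtoC 0) by ring.
      now rewrite Cmod_0. }
    { lia. } { lia. }
    exists (k1, k2). split; [apply in_index_square; lia|].
    rewrite !Cmod_mult, Cmod_R, !Cmod_wfun, Rabs_right by first [assumption | apply Rle_ge, Rmult_le_pos; [lra | apply pos_INR]].
    apply Coef with r1; trivial; now apply wder_ge0.
Qed.

(** The class [Q^2] enters through constants [c] and [K] that enclose [l_j(z) / l_j(z0)] on the
    polydisc for all [z0] at once. The weights are frozen at [z0], the growth estimate is applied,
    and the true weights at [z] are restored. *)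
Lemma local_bound_of_index (beta : R) (l1 l2 : C * C -> R) (F : C * C -> C) (N : nat) (r1 r2 : R) :
  1 < beta -> in_Q2 beta l1 l2 -> holomorphic_bidisc F ->
  (forall z, bidisc z -> forall p1 p2, exists k1 k2, (k1 + k2 <= N)%nat /\
     nder F l1 l2 p1 p2 z <= nder F l1 l2 k1 k2 z) ->
  0 < r1 <= beta -> 0 < r2 <= beta ->
  exists p0, 0 < p0 /\ forall z0, bidisc z0 -> exists k01 k02, (k01 + k02 <= N)%nat /\
    forall k1 k2 z, (k1 + k2 <= N)%nat -> bidisc z -> cpolydisc z0 (r1 / l1 z0) (r2 / l2 z0) z ->
      nder F l1 l2 k1 k2 z <= p0 * nder F l1 l2 k01 k02 z0.
Proof.
  intros Hb [HL [HQ1 HQ2]] HF Hidx Hr1 Hr2.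
  destruct (HQ1 r1 r2 ltac:(lra) ltac:(lra)) as [[c1 [Hc1 Lc1]] [K1 LK1]].
  destruct (HQ2 r1 r2 ltac:(lra) ltac:(lra)) as [[c2 [Hc2 Lc2]] [K2 LK2]].
  (* Comparing with [1] makes the powers of [c] and [K] monotone in the order, as one power for all
     orders requires. *)
  set (c := Rmin 1 (Rmin c1 c2)). set (K := Rmax 1 (Rmax K1 K2)).
  assert (Hc : 0 < c <= 1) by (split; [repeat apply Rmin_pos; lra | apply Rmin_l]).
  assert (Hcc : c <= c1 /\ c <= c2).
  { pose proof (Rmin_r 1 (Rmin c1 c2)). pose proof (Rmin_l c1 c2). pose proof (Rmin_r c1 c2). fold c in H. lra. }
  assert (HK : 1 <= K) by apply Rmax_l.
  assert (HKK : K1 <= K /\ K2 <= K).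
  { pose proof (Rmax_r 1 (Rmax K1 K2)). pose proof (Rmax_l K1 K2). pose proof (Rmax_r K1 K2). fold K in H. lra. }
  pose proof (pow_lt c N ltac:(lra)) as HcN.
  (* Largest total order met by the system: both entries can reach [S N]. *)
  set (M := (S N + S N)%nat).
  pose proof (pow_lt K M ltac:(lra)) as HKM.
  (* Freezing the weights on the dominated side costs [K ^ M]; on the dominating side, where the
     order is at most [N], it costs [1 / c ^ N]. *)
  set (D := K ^ M / c ^ N).
  assert (HD : 0 <= D) by (unfold D; apply Rdiv_le_0_compat; lra).
  set (l := index_square N). set (G := beta * INR (S N) * D).
  set (E := exp (2 * (INR (length l) * G ^ 2 + 1)) * (INR (length l) + 1)).
  pose proof (pos_INR (length l)) as Hlen.
  pose proof (exp_pos (2 * (INR (length l) * G ^ 2 + 1))) as Hexp.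
  assert (HE : 0 < E) by (apply Rmult_lt_0_compat; lra).
  (* The square root undoes the squares in [sum_sq]; [c ^ N] pays for the return from the weights at
     [z0] to those at [z]. *)
  exists (sqrt E / c ^ N). split; [apply Rdiv_lt_0_compat; [now apply sqrt_lt_R0 | trivial]|].
  intros z0 Hz0.
  destruct (admissible_pos beta l1 l2 z0 Hb HL Hz0) as (X & Y & _ & _).
  set (x := l1 z0) in *. set (y := l2 z0) in *.
  destruct (finite_index_argmax (fun k1 k2 => nder F l1 l2 k1 k2 z0) N) as (k01 & k02 & Hk0 & Hmax).
  exists k01, k02. split; trivial.
  intros k1 k2 z Hk Hz Hpoly.
  assert (Cmp : forall w, bidisc w -> cpolydisc z0 (r1 / x) (r2 / y) w ->
    0 < l1 w /\ 0 < l2 w /\ c <= l1 w / x <= K /\ c <= l2 w / y <= K).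
  { intros w Hw Pw. destruct (admissible_pos beta l1 l2 w Hb HL Hw) as (W1 & W2 & _ & _).
    pose proof (Lc1 z0 w Hz0 Hw Pw). pose proof (Lc2 z0 w Hz0 Hw Pw).
    pose proof (LK1 z0 w Hz0 Hw Pw). pose proof (LK2 z0 w Hz0 Hw Pw).
    unfold x, y. repeat split; trivial; lra. }
  set (m := nder F l1 l2 k01 k02 z0).
  assert (Hm : 0 <= m) by now apply (wder_ge0 F x y).
  assert (Frozen : forall w p q, bidisc w -> cpolydisc z0 (r1 / x) (r2 / y) w -> (p <= S N)%nat -> (q <= S N)%nat ->
     exists k1 k2, (k1 + k2 <= N)%nat /\ wder F x y p q w <= D * wder F x y k1 k2 w).
  { intros w p q Hw Pw Hp Hq. destruct (Cmp w Hw Pw) as (W1 & W2 & W3 & W4).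
    destruct (Hidx w Hw p q) as (j1 & j2 & Hj & Hle). exists j1, j2. split; trivial.
    assert (A1 : wder F x y p q w <= nder F l1 l2 p q w * K ^ M).
    { apply (wder_change_le F x y (l1 w) (l2 w)); trivial; try lra. unfold M; lia. }
    assert (A2 : nder F l1 l2 j1 j2 w <= wder F x y j1 j2 w / c ^ N).
    { apply (wder_change_ge F x y (l1 w) (l2 w)); trivial; lra. }
    eapply Rle_trans; [exact A1|].
    replace (D * wder F x y j1 j2 w) with (wder F x y j1 j2 w / c ^ N * K ^ M) by (unfold D; field; lra).
    apply Rmult_le_compat_r; lra. }
  assert (Growth := polydisc_growth F x y r1 r2 D beta z0 z N HF X Y ltac:(lra) ltac:(lra) HD Hz0 Hz Hpoly Frozen).
  cbv zeta in Growth. fold l G in Growth.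
  assert (S0 : sum_sq (fun k _ => wfun F x y k z0) l 0 <= INR (length l) * m ^ 2).
  { apply sum_sq_le. intros [p q] _. rewrite Cmod_wfun by trivial.
    (* The square also contains orders with [p + q > N]; the index bound at [z0] reduces them to
       total order at most [N], where [m] is the maximum. *)
    destruct (Hidx z0 Hz0 p q) as (j1 & j2 & Hj & Hle).
    apply Rle_trans with (1 := Hle). now apply Hmax. }
  assert (S1 : wder F x y k1 k2 z ^ 2 <= sum_sq (fun k _ => wfun F x y k z) l 0).
  { change (wder F x y k1 k2 z) with (wder F x y (fst (k1, k2)) (snd (k1, k2)) z).
    rewrite <- Cmod_wfun by trivial.
    apply (sum_sq_ge (fun k _ => wfun F x y k z) l 0 (k1, k2)). apply in_index_square. lia. }
  assert (B : wder F x y k1 k2 z <= sqrt E * m).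
  { rewrite <- (sqrt_pow2 (wder F x y k1 k2 z)) by now apply wder_ge0.
    rewrite <- (sqrt_pow2 m) by trivial. rewrite <- sqrt_mult by (lra || apply pow2_ge_0).
    apply sqrt_le_1_alt. eapply Rle_trans; [exact S1|]. eapply Rle_trans; [exact Growth|].
    unfold E. rewrite Rmult_assoc. apply Rmult_le_compat_l; [lra|].
    pose proof (pow2_ge_0 m). lra. }
  destruct (Cmp z Hz Hpoly) as (W1 & W2 & W3 & W4).
  apply Rle_trans with (wder F x y k1 k2 z / c ^ N).
  { apply (wder_change_ge F x y (l1 z) (l2 z)); trivial; lra. }
  replace (sqrt E / c ^ N * m) with (sqrt E * m / c ^ N) by (field; lra).
  apply Rmult_le_compat_r; trivial. left. now apply Rinv_0_lt_compat.
Qed.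

(** Reconciles the displayed right-hand side, where the factorials stand under [p0], with the
    normalized derivative. *)
Lemma nder_split F l1 l2 p k1 k2 z :
  0 < l1 z -> 0 < l2 z ->
  p / (INR (fact k1) * INR (fact k2)) * (Cmod (pderiv F k1 k2 z) / (l1 z ^ k1 * l2 z ^ k2))
  = p * nder F l1 l2 k1 k2 z.
Proof.
  intros H1 H2. unfold nder.
  pose proof (INR_fact_lt_0 k1). pose proof (INR_fact_lt_0 k2).
  pose proof (pow_lt _ k1 H1). pose proof (pow_lt _ k2 H2). field. lra.
Qed.

Theorem theorem1 (beta : R) (l1 l2 : C * C -> R) (F : C * C -> C) :
  1 < beta ->
  in_Q2 beta l1 l2 ->
  analytic_bidisc F ->
  (bounded_L_index F l1 l2 <->
   forall r1 r2 : R, 0 < r1 <= beta -> 0 < r2 <= beta ->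
     exists (n0 : nat) (p0 : R), 0 < p0 /\
       forall z0, bidisc z0 ->
         exists k01 k02 : nat, (k01 + k02 <= n0)%nat /\
           forall (k1 k2 : nat) (z : C * C), (k1 + k2 <= n0)%nat -> bidisc z ->
             cpolydisc z0 (r1 / l1 z0) (r2 / l2 z0) z ->
             nder F l1 l2 k1 k2 z <=
               p0 / (INR (fact k01) * INR (fact k02)) *
               (Cmod (pderiv F k01 k02 z0) / (l1 z0 ^ k01 * l2 z0 ^ k02))).
Proof.
  intros Hb HQ HA. pose proof (analytic_holomorphic F HA) as HF.
  assert (HL : admissible_L beta l1 l2) by apply HQ.
  split.
  - intros [N HN] r1 r2 Hr1 Hr2.
    destruct (local_bound_of_index beta l1 l2 F N r1 r2 Hb HQ HF HN Hr1 Hr2) as [p0 [Hp0 H]].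
    exists N, p0. split; trivial. intros z0 Hz0.
    destruct (H z0 Hz0) as (k01 & k02 & Hk0 & Hb0). exists k01, k02. split; trivial.
    intros k1 k2 z Hk Hz Hpoly.
    destruct (admissible_pos beta l1 l2 z0 Hb HL Hz0) as (X & Y & _ & _).
    rewrite nder_split by trivial. now apply Hb0.
  - intros H. destruct (H beta beta ltac:(lra) ltac:(lra)) as (n0 & p0 & Hp0 & H0).
    apply (index_of_local_bound beta l1 l2 F n0 p0); trivial.
    intros z0 Hz0. destruct (H0 z0 Hz0) as (k1 & k2 & Hk & HM). exists k1, k2. split; trivial.
    (* At order [(0, 0)] the normalized derivative is [Cmod (F z)], the quantity that Cauchy's
       estimate takes as input. *)
    intros z Hz Hpoly. specialize (HM 0%nat 0%nat z ltac:(lia) Hz Hpoly).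
    destruct (admissible_pos beta l1 l2 z0 Hb HL Hz0) as (X & Y & _ & _).
    rewrite nder_split in HM by trivial. eapply Rle_trans; [|exact HM].
    right. unfold nder. simpl. change (pderiv F 0 0 z) with (F z). field.
Qed.
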